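(* Let $p\ge 2$ be an integer. Strong $p$-colorability is an invariant of pseudoknots. That is, if $D$ and $D'$ are two pseudodiagrams representing the same pseudoknot (i.e. related by a finite sequence of planar isotopies, classical Reidemeister moves and pseudo-Reidemeister moves), then $D$ is strong $p$-colorable if and only if $D'$ is strong $p$-colorable.
   Context: A pseudodiagram of a knot is a knot diagram in the plane in which, at some of the double points, the over/under information may be missing. Double points with over/under information are called classical crossings; those without it are called precrossings. A pseudoknot is an equivalence class of pseudodiagrams under planar isotopy and the following local moves: the classical Reidemeister moves R1, R2, R3 (involving classical crossings only), and the pseudo-Reidemeister moves: PR1: introduce or remove a kink (monogon) whose crossing is a precrossing. PR2: when a precrossing and a classical crossing are adjacent in a two-strand twist (i.e. they are the two vertices of a bigon), interchange the order of the two along the twist, the classical crossing keeping its sign as a twist: (precrossing, classical crossing) $\leftrightarrow$ (classical crossing, precrossing). PR3 and PR3$'$: slide a strand from one side of a precrossing to the other, where the strand crosses both strands of the precrossing at classical crossings and passes under both of them (one move) or over both of them (the other move), both before and after the slide. Arcs of a pseudodiagram begin and end at classical crossings only, at which they end as under-strands; arcs pass through precrossings (and through classical crossings as over-strands) without being broken. A closed component that is never an under-strand at a classical crossing counts as a single arc. A pseudodiagram is strong $p$-colorable if its arcs can be labelled with elements of $\mathbb{Z}/p\mathbb{Z}$ in a non-trivial way (not all arcs receive the same label), such that: (1) at each classical crossing, two times the element assigned to the over-arc equals the sum of the elements assigned to the two under-arcs, mod $p$; (2) for each precrossing $P$ there are a neighborhood of $P$ and an element $a\in\mathbb{Z}/p\mathbb{Z}$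 such that all arcs of the diagram in the neighborhood are labelled $a$. *)

(* Defs.v *)
From HB Require Import structures.
From mathcomp Require Import all_boot all_order all_algebra.
From mathcomp Require Import all_classical all_reals all_analysis.
From Stdlib Require Import Relation_Operators.

Set Implicit Arguments.
Unset Strict Implicit.
Unset Printing Implicit Defensive.

Import Order.TTheory GRing.Theory Num.Theory.
Import numFieldNormedType.Exports.

Local Open Scope classical_set_scope.
Local Open Scope ring_scope.

(* How a strand goes through a double point; Pre means that the over/under
   information is missing. *)
Inductive passage := Over | Under | Pre.

Definition opposite (l : passage) : passage :=
  match l with Over => Under | Under => Over | Pre => Pre end.

Definition homeomorphism (T U : topologicalType) (h : T -> U) : Prop :=
  continuous h /\
  exists g : U -> T, [/\ continuous g, cancel h g & cancel g h].

(* A closed curve is a map on R of period 1; s and t are two visits of the same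
   point at different points of the circle R/Z. *)
Definition crossing (R : realType) (f : R -> R * R) (s t : R) : Prop :=
  f s = f t /\ s - t \isn't a Num.int.

(* A generic closed curve in the plane, whose only multiple points are finitely
   many transverse double points, together with crossing information.  [level]
   is meaningful only at the parameters of double points.  Transversality:
   some homeomorphism of the plane takes the two branches into the two
   coordinate axes (as the curve is injective near s and t, each branch then
   really goes through the other one). *)
Record pseudodiagram (R : realType) := Pseudodiagram {
  curve :> R -> R * R;
  level : R -> passage;
  curve_continuous : continuous curve;
  curve_periodic : forall t, curve (t + 1) = curve t;
  level_periodic : forall t, level (t + 1) = level t;
  no_triple_point : forall r s t : R,
    curve r = curve s -> curve s = curve t ->
    [\/ r - s \is a Num.int, s - t \is a Num.int | r - t \is a Num.int];
  finitely_many_crossings :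
    finite_set [set s | 0 <= s < 1 /\ exists t, crossing curve s t];
  transverse : forall s t : R, crossing curve s t ->
    exists2 h : R * R -> R * R, homeomorphism h &
      \forall u \near (0 : R),
        (h (curve (s + u))).2 = 0 /\ (h (curve (t + u))).1 = 0;
  level_crossing : forall s t : R, crossing curve s t ->
    level t = opposite (level s)
}.

Definition double_param (R : realType) (D : pseudodiagram R) (s : R) : Prop :=
  exists t, crossing D s t.

Definition underpass (R : realType) (D : pseudodiagram R) (s : R) : Prop :=
  double_param D s /\ level D s = Under.

Section Colorings.
Context {R : realType} (D : pseudodiagram R).

(* Arcs are the pieces into which the underpasses cut the circle R/Z. *)
Definition same_arc (s t : R) : Prop :=
  exists k : int, forall u : R,
    Num.min s (t + k%:~R) <= u <= Num.max s (t + k%:~R) -> ~ underpass D u.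

(* A labelling of the arcs, given by the label of the arc through each
   parameter; its values at underpasses are irrelevant. *)
Definition arc_labelling (p : nat) (c : R -> 'Z_p) : Prop :=
  forall s t, same_arc s t -> c s = c t.

Definition nontrivial_labelling (p : nat) (c : R -> 'Z_p) : Prop :=
  exists s t, [/\ ~ underpass D s, ~ underpass D t & c s <> c t].

(* c (t - u) and c (t + u), for small u > 0, are the labels of the two arcs
   ending at the underpass t. *)
Definition classical_rule (p : nat) (c : R -> 'Z_p) : Prop :=
  forall s t, crossing D s t -> level D s = Over -> level D t = Under ->
    \forall u \near 0^'+, 2%:R * c s = c (t - u) + c (t + u).

Definition precrossing_rule (p : nat) (c : R -> 'Z_p) : Prop :=
  forall s, double_param D s -> level D s = Pre ->
    exists a : 'Z_p, \forall x \near D s,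
      forall t : R, D t = x -> ~ underpass D t -> c t = a.

Definition strong_colorable (p : nat) : Prop :=
  exists c : R -> 'Z_p,
    [/\ arc_labelling c, nontrivial_labelling c,
        classical_rule c & precrossing_rule c].

End Colorings.

(* An ambient isotopy of the plane, up to a change of parametrization of the
   curve (possibly reversing it: diagrams are unoriented). *)
Definition planar_isotopy (R : realType) (D D' : pseudodiagram R) : Prop :=
  exists (H : R -> R * R -> R * R) (phi : R -> R),
    [/\ {within `[0, 1] `*` setT,
           continuous (fun z : R * (R * R) => H z.1 z.2)},
        forall s, 0 <= s <= 1 -> homeomorphism (H s),
        H 0 = id,
        homeomorphism phi /\
        ((forall t, phi (t + 1) = phi t + 1) \/
         (forall t, phi (t + 1) = phi t - 1)) &
        forall t, D' t = H 1 (D (phi t)) /\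
                  (double_param D' t -> level D' t = level D (phi t))].

(* The n strands of a local picture in the square [-1, 1]^2, each parametrized
   by [-1, 1]; [tangle_level i j v] is the level of strand i at its parameter v,
   when it meets strand j there. *)
Record tangle (R : realType) (n : nat) := Tangle {
  strand : 'I_n -> R -> R * R;
  tangle_level : 'I_n -> 'I_n -> R -> passage
}.

(* In the chart h, the part of D parametrized by the n segments
   c i + r i * [-1, 1] is the picture T. *)
Definition pictures (R : realType) (n : nat) (T : tangle R n)
    (h : R * R -> R * R) (c r : 'I_n -> R) (D : pseudodiagram R) : Prop :=
  (forall i v, -1 <= v <= 1 -> h (D (c i + r i * v)) = strand T i v) /\
  (forall i j v w, -1 <= v <= 1 -> -1 <= w <= 1 -> (i, v) <> (j, w) ->
     strand T i v = strand T j w ->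
     level D (c i + r i * v) = tangle_level T i j v).

(* D and D' coincide outside the disk h^-1([-1, 1]^2), and in this disk D is T
   whereas D' is T'.  The r i may be negative, so that D may run through the
   strands of T in any direction; h may reverse the orientation, so that each
   picture also stands for its mirror image in the plane. *)
Definition local_move (R : realType) (n : nat) (T T' : tangle R n)
    (D D' : pseudodiagram R) : Prop :=
  exists (h : R * R -> R * R) (c r : 'I_n -> R),
    [/\ homeomorphism h,
        (forall i v, -1 <= v <= 1 -> 0 < c i + r i * v < 1) /\
        (forall i j v w, -1 <= v <= 1 -> -1 <= w <= 1 ->
           c i + r i * v = c j + r j * w -> i = j /\ v = w),
        pictures T h c r D,
        pictures T' h c r D' &
        forall t, 0 <= t < 1 ->
          (forall i v, -1 <= v <= 1 -> t <> c i + r i * v) ->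
          [/\ D' t = D t,
              double_param D t -> level D' t = level D t &
              ~ (-1 <= (h (D t)).1 <= 1 /\ -1 <= (h (D t)).2 <= 1)]].

Section Pictures.
Context {R : realType}.

Definition flat : tangle R 1 :=
  Tangle (fun _ v => (v, 0)) (fun _ _ _ => Pre).

(* A nodal cubic, with its double point (0, 3/8) at v = -1/2 and v = 1/2. *)
Definition kink (l : passage) : tangle R 1 :=
  Tangle (fun _ v => (v * (4 * v ^+ 2 - 1) / 3, (1 - v ^+ 2) / 2))
         (fun _ _ v => if v < 0 then l else opposite l).

(* The levels when strand i lies entirely at height ht i. *)
Definition by_height (n : nat) (ht : 'I_n -> nat) (i j : 'I_n) (_ : R) :
    passage :=
  if (ht j < ht i)%N then Over else if (ht i < ht j)%N then Under else Pre.

Definition parallel_strands (i : 'I_2) (v : R) : R * R :=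
  (v, if i == ord0 then 0 else 1 / 2).

(* A bigon, with vertices at v = -1/2 and v = 1/2. *)
Definition bigon_strands (i : 'I_2) (v : R) : R * R :=
  (v, if i == ord0 then 0 else (4 * v ^+ 2 - 1) / 6).

Definition separate (ht : 'I_2 -> nat) : tangle R 2 :=
  Tangle parallel_strands (by_height ht).

Definition overlap (ht : 'I_2 -> nat) : tangle R 2 :=
  Tangle bigon_strands (by_height ht).

(* Reading the bigon from left to right as a two-crossing twist, strand 0 comes
   from below at v = -1/2, and strand 1 at v = 1/2.  The sign of a classical
   crossing as a twist is the level l of the strand that comes from below. *)
Definition twist_level (l : passage) (i : 'I_2) (v : R) : passage :=
  if (i == ord0) == (v < 0) then l else opposite l.

Definition pre_then_classical (l : passage) : tangle R 2 :=
  Tangle bigon_strands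
    (fun i _ v => if v < 0 then Pre else twist_level l i v).

Definition classical_then_pre (l : passage) : tangle R 2 :=
  Tangle bigon_strands
    (fun i _ v => if v < 0 then twist_level l i v else Pre).

(* Strands 0 and 1 cross at the origin; strand 2 goes above the origin for
   e = 1 and below it for e = -1, and meets the other two at v = -1/2 and
   v = 1/2. *)
Definition slide_strands (e : R) (i : 'I_3) (v : R) : R * R :=
  (v, match val i with
      | 0%N => v / 2
      | 1%N => - v / 2
      | _ => e * (1 - v ^+ 2) / 3
      end).

Definition slide (e : R) (ht : 'I_3 -> nat) : tangle R 3 :=
  Tangle (slide_strands e) (by_height ht).

End Pictures.

Inductive move (R : realType) (D D' : pseudodiagram R) : Prop :=
| Isotopy of planar_isotopy D D'
| R1 (l : passage) of l <> Pre & local_move flat (kink l) D D'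
| R2 (ht : 'I_2 -> nat) of injective ht &
    local_move (separate ht) (overlap ht) D D'
| R3 (ht : 'I_3 -> nat) of injective ht &
    local_move (slide 1 ht) (slide (-1) ht) D D'
| PR1 of local_move flat (kink Pre) D D'
| PR2 (l : passage) of l <> Pre &
    local_move (pre_then_classical l) (classical_then_pre l) D D'
| PR3 (ht : 'I_3 -> nat) of
    ht (inord 0) = ht (inord 1) & (ht (inord 2) < ht (inord 0))%N &
    local_move (slide 1 ht) (slide (-1) ht) D D'
| PR3' (ht : 'I_3 -> nat) of
    ht (inord 0) = ht (inord 1) & (ht (inord 0) < ht (inord 2))%N &
    local_move (slide 1 ht) (slide (-1) ht) D D'.

Definition same_pseudoknot (R : realType) :
    pseudodiagram R -> pseudodiagram R -> Prop :=
  clos_refl_sym_trans _ (@move R).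

(* Main.v *)
Require Import Defs.
From mathcomp Require Import all_boot all_order all_algebra.
From mathcomp Require Import all_classical all_reals all_analysis.
From mathcomp Require Import zify ring lra.

Set Implicit Arguments.
Unset Strict Implicit.
Unset Printing Implicit Defensive.

Import Order.TTheory GRing.Theory Num.Theory.
Import numFieldNormedType.Exports.

Local Open Scope classical_set_scope.
Local Open Scope ring_scope.

(* Being a colouring is a local condition on a labelling of the circle R/Z: it
   only involves the labels just before and just after each parameter.  Hence a
   colouring can be transported along a planar isotopy, and changed inside the
   disk of a local move independently of the rest.  At a double point, the
   labels on one side determine those on the other side.  So it is enough to
   extend the labels at the ends of the strands of a picture to the other
   picture of the move: for the slides this is the Yang-Baxter equation of the
   dihedral quandle, also when the two strands that are not slid meet at a
   precrossing, and for the pictures of R1, PR1 and PR2 the rules force all the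
   labels to be equal.  Nontriviality is preserved because a picture with equal
   labels at all its ends has the same label everywhere. *)

(** * Germs of labellings *)

(** An underpass lies on two arcs, so no single value can be its label: this is why germs ignore the
    value at their centre. The rule at a double point survives exchanging before and after on either
    strand, because the reflection [x -> 2 y - x] is an involution; hence orientations never matter,
    although charts may run strands backwards. Only identities valid in every commutative ring occur
    and 2 is never inverted, so even [p] is covered. Two facts make a change inside a disk
    independent of the rest: no double point joins a strand of the picture to the outside, and none
    sits at an end of a strand, so that labels are constant near the ends on both sides. Since all
    pictures cross at the parameters -1/2, 0, 1/2 only, a labelling of a picture amounts to four
    labels per strand, and what remains about each move is finite algebra. *)

Lemma oppositeK : involutive opposite.
Proof. by case. Qed.

Section Germs.
Context {R : realType} {A : comPzRingType}.
Implicit Types (f g : R -> A) (v w : R) (l : passage).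

Lemma nearE (P : R -> Prop) v :
  (\forall u \near v, P u) <->
  exists2 e, 0 < e & forall u, `|u - v| < e -> P u.
Proof.
split=> [/nbhs_ballP[e /= e0 H]|[e e0 H]].
  by exists e => // u uv; apply: H; rewrite /ball /= distrC.
apply/nbhs_ballP; exists e => //= u; rewrite /ball /= => uv.
by apply: H; rewrite distrC.
Qed.

(** The value [f v] is left out on purpose: at an underpass it is arbitrary, and [x] and [y] then
    label two different arcs. *)
Definition germ f v (x y : A) : Prop :=
  exists2 e, 0 < e &
    forall u, 0 < u < e -> f (v - u) = x /\ f (v + u) = y.

Lemma germ_unique f v x y x' y' :
  germ f v x y -> germ f v x' y' -> x = x' /\ y = y'.
Proof.
move=> [e e0 H] [e' e'0 H'].
have h : 0 < Num.min e e' / 2 by rewrite divr_gt0 // lt_min e0.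
have [he he'] : Num.min e e' / 2 < e /\ Num.min e e' / 2 < e'.
  have h1 : Num.min e e' <= e by rewrite ge_min lexx.
  have h2 : Num.min e e' <= e' by rewrite ge_min lexx orbT.
  split; lra.
have [|<- <-] := H (Num.min e e' / 2); first by rewrite h.
by have [|<- <-] := H' (Num.min e e' / 2); first by rewrite h.
Qed.

Lemma germ_near f g v x y :
  (\forall u \near v, f u = g u) -> germ f v x y -> germ g v x y.
Proof.
move=> /nearE[d d0 fg] [e e0 H]; exists (Num.min d e).
  by rewrite lt_min d0.
move=> u; rewrite lt_min => /and3P[u0 ud ue].
rewrite -!fg; first by apply: H; rewrite u0.
  by rewrite [v + u]addrC addrK gtr0_norm.
by rewrite [v - u]addrC addrK normrN gtr0_norm.
Qed.

Lemma germ_comp_inc f (phi : R -> R) v x y :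
  {for v, continuous phi} -> {mono phi : a b / a < b} ->
  germ f (phi v) x y -> germ (f \o phi) v x y.
Proof.
move=> phic phim [e e0 H].
have /nearE[d d0 D] : \forall u \near v, `|phi v - phi u| < e.
  by move/cvgrPdist_lt: phic => /(_ e e0).
exists d => // u /andP[u0 ud].
have a1 : phi (v - u) < phi v by rewrite phim; lra.
have a2 : phi v < phi (v + u) by rewrite phim; lra.
have b1 : `|phi v - phi (v - u)| < e.
  by apply: D; rewrite [v - u]addrC addrK normrN gtr0_norm.
have b2 : `|phi v - phi (v + u)| < e.
  by apply: D; rewrite [v + u]addrC addrK gtr0_norm.
move: b1 b2; rewrite ltr_norml => /andP[_ b1]; rewrite ltr_norml => /andP[b2 _].
have [|<- _] := H (phi v - phi (v - u)); first by apply/andP; split; lra.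
have [|_ <-] := H (phi (v + u) - phi v); first by apply/andP; split; lra.
by rewrite /= subKr [phi v + _]addrC subrK.
Qed.

Lemma germ_opp f v x y : germ f (- v) x y -> germ (f \o -%R) v y x.
Proof.
move=> [e e0 H]; exists e => // u /H[<- <-].
by rewrite /= opprB opprD [u - v]addrC.
Qed.

Lemma germ_comp_dec f (phi : R -> R) v x y :
  {for v, continuous phi} -> {mono phi : a b /~ a < b} ->
  germ f (phi v) x y -> germ (f \o phi) v y x.
Proof.
move=> phic phim H.
have := @germ_comp_inc (f \o -%R) (-%R \o phi) v y x _ _ _.
have -> : (f \o -%R) \o (-%R \o phi) = f \o phi.
  by apply/funext => u /=; rewrite opprK.
apply.
- by apply: continuousN.
- by move=> a b /=; rewrite ltrN2 phim.
- by apply: germ_opp; rewrite opprK.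
Qed.

Definition strictly_monotone (phi : R -> R) : Prop :=
  {mono phi : a b / a < b} \/ {mono phi : a b /~ a < b}.

Lemma germ_comp_const f (phi : R -> R) v x :
  {for v, continuous phi} -> strictly_monotone phi ->
  germ f (phi v) x x -> germ (f \o phi) v x x.
Proof.
by move=> c [m|m]; [apply: germ_comp_inc|apply: germ_comp_dec].
Qed.

Lemma germ_constP f v :
  germ f v (f v) (f v) <-> \forall u \near v, f u = f v.
Proof.
split=> [[e e0 H]|/nearE[e e0 H]]; last first.
  exists e => // u /andP[u0 ue]; split; apply: H.
    by rewrite [v - u]addrC addrK normrN gtr0_norm.
  by rewrite [v + u]addrC addrK gtr0_norm.
apply/nearE; exists e => // u; have [uv|uv|-> //] := ltgtP u v.
- rewrite ltr0_norm ?subr_lt0// opprB => h.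
  have [|<- _] := H (v - u); first by rewrite subr_gt0 uv.
  by rewrite subKr.
- rewrite gtr0_norm ?subr_gt0// => h.
  have [|_ <-] := H (u - v); first by rewrite subr_gt0 uv.
  by rewrite addrC subrK.
Qed.

(* [x], [x'] label the germs of a strand of level [l] before and after a double
   point, [y], [y'] those of the other strand. *)
Definition crossing_rule l (x x' y y' : A) : Prop :=
  match l with
  | Over => x' = x /\ y' = 2%:R * x - y
  | Under => y' = y /\ x' = 2%:R * y - x
  | Pre => [/\ x' = x, y' = y & x = y]
  end.

Lemma crossing_rule_sym l x x' y y' :
  crossing_rule l x x' y y' -> crossing_rule (opposite l) y y' x x'.
Proof. by case: l => //= -[-> -> ->]. Qed.

(** Reflections are involutions, so the rule does not see in which direction a strand is run. *)
Lemma crossing_rule_revl l x x' y y' :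
  crossing_rule l x x' y y' -> crossing_rule l x' x y y'.
Proof.
case: l => /= [[-> ->]|[-> ->]|[-> -> ->]] //.
by rewrite subKr.
Qed.

Lemma crossing_rule_revr l x x' y y' :
  crossing_rule l x x' y y' -> crossing_rule l x x' y' y.
Proof.
case: l => /= [[-> ->]|[-> ->]|[-> -> ->]] //.
by rewrite subKr.
Qed.

Lemma crossing_rule_nonunder l x x' y y' :
  crossing_rule l x x' y y' -> l <> Under -> x' = x.
Proof. by case: l => //= -[]. Qed.

Lemma crossing_rule_const l b x' y' :
  crossing_rule l b x' b y' -> x' = b /\ y' = b.
Proof. by case: l => /= -[-> ->] //; split=> //; ring. Qed.

(** A passage that is not under belongs to the arc around it, so the value at [v] is tied to the
    germ; at an underpass it stays free. *)
Definition strand_germ f v l (x y : A) : Prop :=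
  germ f v x y /\ (l <> Under -> f v = x).

Definition rule_at f v l g w : Prop :=
  exists x x' y y', [/\ strand_germ f v l x x',
    strand_germ g w (opposite l) y y' & crossing_rule l x x' y y'].

Lemma rule_at_sym f v l g w : rule_at f v l g w -> rule_at g w (opposite l) f v.
Proof.
move=> [x [x' [y [y' [a b /crossing_rule_sym c]]]]].
exists y, y', x, x'; split => //.
by case: l a {b c}.
Qed.

Lemma rule_at_near f f' v l g w : (\forall u \near v, f u = f' u) ->
  rule_at f v l g w -> rule_at f' v l g w.
Proof.
move=> ff' [x [x' [y [y' [[a a'] b c]]]]].
exists x, x', y, y'; split => //; split; first exact: germ_near a.
by move=> /a' <-; apply/esym/(nbhs_singleton ff').
Qed.

Lemma rule_at_comp f (phi : R -> R) v l g w :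
  {for v, continuous phi} -> strictly_monotone phi ->
  rule_at f (phi v) l g w -> rule_at (f \o phi) v l g w.
Proof.
move=> phic phim [x [x' [y [y' [[a a'] b c]]]]].
case: phim => phim.
  exists x, x', y, y'; split => //; split=> //.
  exact: germ_comp_inc.
exists x', x, y, y'; split => //; last exact: crossing_rule_revl.
split; first exact: germ_comp_dec.
by move=> lU; rewrite (crossing_rule_nonunder c lU); apply: a'.
Qed.

Lemma rule_at_comp2 f g (phi psi : R -> R) v l w :
  {for v, continuous phi} -> strictly_monotone phi ->
  {for w, continuous psi} -> strictly_monotone psi ->
  rule_at f (phi v) l g (psi w) -> rule_at (f \o phi) v l (g \o psi) w.
Proof.
move=> phic phim psic psim /(rule_at_comp phic phim) /rule_at_sym.
by move=> /(rule_at_comp psic psim) /rule_at_sym; rewrite oppositeK.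
Qed.

Lemma rule_at_nonunder f v l g w : rule_at f v l g w -> l <> Under ->
  germ f v (f v) (f v).
Proof.
move=> [x [x' [y [y' [[a a'] _ c]]]]] lU.
by rewrite (a' lU); move: a; rewrite (crossing_rule_nonunder c lU).
Qed.

Lemma locally_const_segment f a b : a <= b ->
  (forall v, a <= v <= b -> germ f v (f v) (f v)) -> f a = f b.
Proof.
(* Connectedness of the segment by the intermediate value theorem: the indicator of the value [f a]
   is continuous, and if [f b] were different it would have to take the value 1/2. *)
move=> ab H; pose g (u : R) : R := if f u == f a then 1 else 0.
have gc : {within `[a, b], continuous g}.
  apply: continuous_in_subspaceT => u; rewrite inE /= in_itv /= => /H.
  
  move=> /germ_constP fu P /nbhs_singleton Pu.
  by apply: filterS fu => w fw; rewrite /= /g fw.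
apply/esym/eqP; apply/negPn/negP => fab.
have [|c _] := @IVT R g a b (1 / 2) ab gc.
  rewrite /g eqxx (negbTE fab) ge_min le_max; apply/andP; split; apply/orP.
    right; lra.
  left; lra.
rewrite /g; case: ifP => _; lra.
Qed.

End Germs.

(** * Local colourings *)

Lemma int_lt_lt1 (R : realType) (m n : int) :
  m%:~R < n%:~R :> R -> n%:~R < m%:~R + 1 :> R -> False.
Proof.
rewrite ltr_int => mn; have -> : m%:~R + 1 = (m + 1)%:~R :> R by rewrite intrD.
by rewrite ltr_int ltzD1 leNgt mn.
Qed.

Lemma near_not_congruent (R : realType) (t x : R) :
  \forall u \near t, u <> t -> u - x \isn't a Num.int.
Proof.
have /andP[f1 f2] := floor_itv (t - x).
set m := Num.floor (t - x) in f1 f2; rewrite intrD in f2.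
have [E|E] := eqVneq (t - x) m%:~R.
  apply/nearE; exists 1 => // u; rewrite ltr_norml => /andP[u1 u2] ut.
  apply/negP => /intrP[n nE].
  have [h|h|h] := ltgtP u t; last exact: ut.
    by apply: (@int_lt_lt1 R n m); lra.
  by apply: (@int_lt_lt1 R m n); lra.
have f3 : m%:~R < t - x by rewrite lt_neqAle f1 eq_sym E.
apply/nearE; exists (Num.min (t - x - m%:~R) (m%:~R + 1 - (t - x))).
  by rewrite lt_min; apply/andP; split; lra.
move=> u; rewrite lt_min !ltr_norml => /andP[/andP[u1 u2] /andP[u3 u4]] _.
apply/negP => /intrP[n nE].
by apply: (@int_lt_lt1 R m n); lra.
Qed.

Lemma periodic_int (R : realType) (T : Type) (f : R -> T) :
  (forall t, f (t + 1) = f t) -> forall t (n : int), f (t + n%:~R) = f t.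
Proof.
move=> f1.
have fn t (n : nat) : f (t + n%:R) = f t.
  by elim: n => [|n IH]; rewrite ?mulr0n ?addr0 // -natr1 addrA f1.
move=> t [n|n]; first exact: fn.
by rewrite NegzE mulrNz -(fn (t - n.+1%:~R) n.+1) subrK.
Qed.

Section LocalColorings.
Context {R : realType} (D : pseudodiagram R).

Lemma curve_int t (n : int) : D (t + n%:~R) = D t.
Proof. exact/periodic_int/curve_periodic. Qed.

Lemma level_int t (n : int) : level D (t + n%:~R) = level D t.
Proof. exact/periodic_int/level_periodic. Qed.

Lemma crossing_sym s t : crossing D s t -> crossing D t s.
Proof. by move=> [e h]; split; rewrite ?e // -opprB rpredN. Qed.

Lemma crossing_int s t (n : int) : crossing D (s + n%:~R) t <-> crossing D s t.
Proof.
rewrite /crossing curve_int; suff -> : (s + n%:~R - t \isn't a Num.int) =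
  (s - t \isn't a Num.int) by [].
by rewrite addrAC rpredDr ?intr_int.
Qed.

Lemma double_param_int t (n : int) :
  double_param D (t + n%:~R) <-> double_param D t.
Proof. by split=> -[s /crossing_int h]; exists s. Qed.

Lemma underpass_int t (n : int) : underpass D (t + n%:~R) <-> underpass D t.
Proof. by rewrite /underpass double_param_int level_int. Qed.

(** Finiteness is assumed over one period only. Each double parameter is congruent to one of the
    finitely many in [[0, 1[], and each congruence class modulo 1 is discrete. *)
Lemma near_not_double t :
  \forall u \near t, u <> t -> ~ double_param D u.
Proof.
have [F FE] := (finite_seqP _).1 (finitely_many_crossings D).
have H : \forall u \near t, forall x, x \in F -> u <> t ->
    u - x \isn't a Num.int.
  elim: F {FE} => [|x F IH]; first exact: filterE.
  apply: filterS2 IH (near_not_congruent t x) => u h hx y.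
  by rewrite inE => /orP[/eqP ->|/h].
apply: filterS H => u H ut ud.
have /andP[f1 f2] := floor_itv u; rewrite intrD in f2.
have /negP[] : u - (u - (Num.floor u)%:~R) \isn't a Num.int.
  apply: H => //.
  suff : [set` F] (u - (Num.floor u)%:~R) by [].
  rewrite -FE /=; split; first by apply/andP; split; lra.
  by apply/(double_param_int _ (Num.floor u)); rewrite subrK.
by rewrite subKr intr_int.
Qed.

Variable p : nat.
Implicit Type c : R -> 'Z_p.

(* Periodicity is also required at underpasses, where the label is junk. *)
Definition local_coloring c : Prop :=
  [/\ forall t (n : int), c (t + n%:~R) = c t,
      forall t, ~ double_param D t -> germ c t (c t) (c t) &
      forall s t, crossing D s t -> rule_at c s (level D s) c t].

Lemma local_coloring_nonunder c t :
  local_coloring c -> ~ underpass D t -> germ c t (c t) (c t).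
Proof.
move=> [_ c1 c2] tU; have [[s ts]|/c1 //] := pselect (double_param D t).
apply: rule_at_nonunder (c2 _ _ ts) _ => lU; apply: tU; split=> //.
by exists s.
Qed.

(** Double parameters are isolated, so near [t] the only possible cut is [t] itself; two parameters
    are then separated only when [t] is an underpass lying between them. *)
Lemma same_arc_near t : exists2 e, 0 < e & forall u v,
  `|u - t| < e -> `|v - t| < e ->
  (underpass D t -> (t < u /\ t < v) \/ (u < t /\ v < t)) -> same_arc D u v.
Proof.
have /nearE[e e0 H] := near_not_double t; exists e => // u v.
rewrite !ltr_norml => /andP[u1 u2] /andP[v1 v2] tU.
exists 0 => w; rewrite addr0 ge_min le_max => /andP[/orP w1 /orP w2] wU.
have [wt|/eqP wt] := eqVneq w t.
  by rewrite wt in wU w1 w2; case: (tU wU) => -[? ?]; case: w1; case: w2; lra.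
case: wU => + _; apply: H => //; rewrite ltr_norml; apply/andP.
by case: w1; case: w2 => ? ?; split; lra.
Qed.

Lemma arc_germ c t : arc_labelling D c -> exists x y, germ c t x y.
Proof.
move=> ca; have [e e0 H] := same_arc_near t.
exists (c (t - e / 2)), (c (t + e / 2)), e => // u /andP[u0 ue].
split; apply: ca; apply: H; try (by rewrite ltr_norml; apply/andP; split; lra).
- by move=> _; right; split; lra.
- by move=> _; left; split; lra.
Qed.

Lemma arc_germ_const c t :
  arc_labelling D c -> ~ underpass D t -> germ c t (c t) (c t).
Proof.
move=> ca tU; have [e e0 H] := same_arc_near t.
by exists e => // u /andP[u0 ue]; split; apply: ca; apply: H => //;
  rewrite ltr_norml; apply/andP; split; lra.
Qed.

Lemma same_arc_nonunder s t : same_arc D s t -> ~ underpass D s /\ ~ underpass D t.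
Proof.
move=> [k H]; split; first by apply: H; rewrite ge_min le_max lexx.
by rewrite -(underpass_int t k); apply: H; rewrite ge_min le_max lexx !orbT.
Qed.

Lemma same_arc_floor t : ~ underpass D t ->
  same_arc D t (t - (Num.floor t)%:~R).
Proof.
by move=> tU; exists (Num.floor t) => u; rewrite subrK minxx maxxx => /le_anti <-.
Qed.

(** The values of [c] at underpasses are arbitrary and need not be periodic. Extending [c]
    periodically from [[0, 1[] repairs this and changes it at underpasses only, since elsewhere [t]
    and [t] minus its floor are on the same arc. *)
Lemma coloring_local c :
  arc_labelling D c -> classical_rule D c -> precrossing_rule D c ->
  exists2 c', local_coloring c' & forall t, ~ underpass D t -> c' t = c t.
Proof.
move=> ca cc cp; pose c' t := c (t - (Num.floor t)%:~R).
have c'E t : ~ underpass D t -> c' t = c t.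
  by move=> /same_arc_floor /ca.
have c'a : arc_labelling D c'.
  move=> s t st; have [sU tU] := same_arc_nonunder st.
  by rewrite !c'E //; apply: ca.
exists c' => //; split.
- move=> t n; rewrite /c'; congr c.
  by rewrite floorDrz ?intr_int // intrKfloor intrD opprD addrACA subrr addr0.
- by move=> t tU; apply: arc_germ_const => // -[].
have over s t : crossing D s t -> level D s = Over -> rule_at c' s Over c' t.
  move=> st sO; have tU : level D t = Under by rewrite (level_crossing st) sO.
  have sN : ~ underpass D s by move=> [_]; rewrite sO.
  have [x [y /[dup] g [e e0 H]]] := arc_germ t c'a.
  exists (c' s), (c' s), x, y; split=> //; first by split=> //; apply: arc_germ_const.
  split=> //.
  have h := cc s t st sO tU.
  have : 2%:R * c s = x + y; last by rewrite c'E // => ->; rewrite addrC addKr.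
  (* The rule is known for [c] and the germ for [c']. For small [u] the parameters [t - u] and
     [t + u] are not double, so both labellings agree there. *)
  have [d d0 N] := (nearE _ _).1 (near_not_double t).
  have /nbhs_right0P h' := h.
  near (0 : R)^'+ => u.
  have u0 : 0 < u by near: u; apply: nbhs_right_gt.
  have ue : u < e by near: u; apply: nbhs_right_lt.
  have ud : u < d by near: u; apply: nbhs_right_lt.
  have [|<- <-] := H u; first by rewrite u0.
  rewrite !c'E; first by near: u.
    move=> [+ _]; apply: N; first by rewrite [t + u]addrC addrK gtr0_norm.
    lra.
  move=> [+ _]; apply: N; last by lra.
  by rewrite [t - u]addrC addrK normrN gtr0_norm.
move=> s t st; case sl: (level D s).
- exact: over.
- have tl : level D t = Over by rewrite (level_crossing st) sl.
  exact: rule_at_sym (over _ _ (crossing_sym st) tl).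
- have tl : level D t = Pre by rewrite (level_crossing st) sl.
  have sN : ~ underpass D s by move=> [_]; rewrite sl.
  have tN : ~ underpass D t by move=> [_]; rewrite tl.
  have sd : double_param D s by exists t.
  (* Evaluated at the double point itself, the rule gives both visits the same label. *)
  have [a /nbhs_singleton ha] := cp _ sd sl.
  exists (c' s), (c' s), (c' t), (c' t); split.
  + by split=> //; apply: arc_germ_const.
  + by split=> //; apply: arc_germ_const.
  + by split => //; rewrite !c'E // (ha s) // (ha t) //; case: st.
Unshelve. all: by end_near. Qed.

Lemma local_arc_labelling c : local_coloring c -> arc_labelling D c.
Proof.
move=> cl s t [k H]; have [cper _ _] := cl.
rewrite -(cper t k); move: H; set t' := t + _ => H.
wlog : s t' H / s <= t'.
  move=> W; have [/W|/ltW /W] := leP s t'; first exact.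
  by rewrite minC maxC => /(_ H).
move=> st'; apply: locally_const_segment => // v; rewrite -{1}(min_l st') => vI.
apply: local_coloring_nonunder => //; apply: H.
by move: vI; rewrite (max_r st').
Qed.

Lemma local_classical_rule c : local_coloring c -> classical_rule D c.
Proof.
move=> [_ _ cr] s t st sO tU; have := cr s t st; rewrite sO.
move=> [x [x' [y [y' [[_ sE] [[e e0 H] _] [_ yE]]]]]].
near=> u; have [|-> ->] := H u.
  apply/andP; split; near: u; [exact: nbhs_right_gt|exact: nbhs_right_lt].
by rewrite sE // yE addrC subrK.
Unshelve. all: by end_near. Qed.

(* The parameters in [0, 1] near which [c] is not constantly [c s] form a
   compact set, whose image misses the double point. *)
Lemma local_precrossing_rule c : local_coloring c -> precrossing_rule D c.
Proof.
move=> cl s [t st] sl; have [cper _ cr] := cl.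
have cst : c s = c t.
  have := cr s t st; rewrite sl => -[x [x' [y [y' [[_ sE] [_ tE] [_ _ xy]]]]]].
  by rewrite sE // tE.
have tl : level D t = Pre by rewrite (level_crossing st) sl.
pose G := [set u | c u = c s]°.
(* As there are no triple points, every visit of this double point is congruent to [s] or to [t];
   near both, [c] is constantly [c s]. *)
have Gu u : D u = D s -> G u.
  move=> us; have [cE lE] : c u = c s /\ level D u = Pre.
    have [/intrP[n nE]|sti|/intrP[n nE]] := no_triple_point us st.1.
    - by rewrite -(subrK s u) nE addrC cper level_int.
    - by case: st => _ /negP[].
    - by rewrite -(subrK t u) nE addrC cper level_int.
  have /(local_coloring_nonunder cl) : ~ underpass D u by move=> [_]; rewrite lE.
  by move=> /germ_constP; rewrite cE.
pose K := `[0, 1] `&` ~` G.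
have Kc : closed (D @` K).
  apply: compact_closed; first exact: norm_hausdorff.
  apply: continuous_compact.
    exact/continuous_subspaceT/curve_continuous.
  apply: (@subclosed_compact _ K `[0, 1]); last by move=> ? [].
    apply: closedI; first exact: itv_closed.
    exact/open_closedC/open_interior.
  exact: segment_compact.
exists (c s).
have : nbhs (D s) (~` (D @` K)).
  apply: open_nbhs_nbhs; split; first exact: closed_openC.
  by move=> [u [_ uG] us]; apply/uG/Gu.
apply: filterS => x xK u ux _.
rewrite -(cper u (- Num.floor u)); apply: contrapT => uG.
apply: xK; exists (u + (- Num.floor u)%:~R); last by rewrite curve_int.
split; last by move=> /interior_subset.
have /andP[f1 f2] := floor_itv u; rewrite intrD in f2.
by rewrite /= in_itv /= intrN; apply/andP; split; lra.
Qed.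

End LocalColorings.

Lemma strong_colorableP (R : realType) (D : pseudodiagram R) (p : nat) :
  strong_colorable D p <->
  exists2 c : R -> 'Z_p, local_coloring D c & nontrivial_labelling D c.
Proof.
split=> [[c [ca [s [t [sU tU st]]] cc cp]]|[c cl cn]]; last first.
  exists c; split => //.
  - exact: local_arc_labelling.
  - exact: local_classical_rule.
  - exact: local_precrossing_rule.
have [c' c'l c'E] := coloring_local ca cc cp.
by exists c' => //; exists s, t; rewrite !c'E.
Qed.

(** * Planar isotopies *)

Lemma homeomorphism_monotone (R : realType) (phi : R -> R) :
  homeomorphism phi -> strictly_monotone phi.
Proof.
move=> [phic [psi [_ phiK _]]].
have := @itv_continuous_inj_mono R phi `]-oo, +oo[%R _ _.
move=> []; [exact: continuous_subspaceT|by move=> x y _ _; apply: (can_inj phiK)| |] => m.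
  by left; apply/leW_mono/le_mono => a b; apply: m; rewrite in_itv.
by right; apply/leW_nmono/le_nmono => a b; apply: m; rewrite in_itv.
Qed.

(** Keeps the final homeomorphism of an isotopy and the degree [e] of the change of parameter, a
    relation that is inverted directly. The equation [e * e = 1] makes [e] equal to 1 or -1 and
    treats both directions of travel at once. *)
Definition reparametrized (R : realType) (D D' : pseudodiagram R) : Prop :=
  exists (g : R * R -> R * R) (phi : R -> R),
    [/\ homeomorphism g, homeomorphism phi,
        exists2 e : int, e * e = 1 & forall t, phi (t + 1) = phi t + e%:~R &
        forall t, D' t = g (D (phi t)) /\
                  (double_param D' t -> level D' t = level D (phi t))].

Section Reparametrization.
Context {R : realType}.
Implicit Types D : pseudodiagram R.

Lemma isotopy_reparametrized D D' :
  planar_isotopy D D' -> reparametrized D D'.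
Proof.
move=> [H [phi [_ Hh _ [phih phi1] DD']]]; exists (H 1), phi; split => //.
  by apply: Hh; rewrite ler01 lexx.
by case: phi1 => phi1; [exists 1|exists (-1)].
Qed.

Lemma phi_int (phi : R -> R) (e : int) : (forall t, phi (t + 1) = phi t + e%:~R) ->
  forall t (n : int), phi (t + n%:~R) = phi t + (e * n)%:~R.
Proof.
move=> phi1 t n.
(* Subtracting the linear part [e * t] from [phi] leaves a function of period 1. *)
have := @periodic_int R R (fun t => phi t - e%:~R * t) _ t n.
rewrite intrM mulrDr => H; rewrite -(subrK (e%:~R * (t + n%:~R)) (phi _)) mulrDr H.
  by rewrite addrA subrK.
by move=> u; rewrite phi1 mulrDr mulr1; ring.
Qed.

Lemma phi_intE (phi : R -> R) (e : int) :
  injective phi -> e * e = 1 -> (forall t, phi (t + 1) = phi t + e%:~R) ->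
  forall s t, (phi s - phi t \is a Num.int) = (s - t \is a Num.int).
Proof.
move=> phiI ee /phi_int phin s t; apply/intrP/intrP => -[n nE].
  exists (e * n); apply/eqP; rewrite subr_eq addrC; apply/eqP/phiI.
  by rewrite phin mulrA ee mul1r -nE addrC subrK.
by exists (e * n); rewrite -[s](subrK t) nE [n%:~R + t]addrC phin addrC addKr.
Qed.

Lemma reparametrized_crossing D D' g phi (e : int) :
  injective g -> injective phi -> e * e = 1 ->
  (forall t, phi (t + 1) = phi t + e%:~R) -> (forall t, D' t = g (D (phi t))) ->
  forall s t, crossing D' s t <-> crossing D (phi s) (phi t).
Proof.
move=> gI phiI ee phi1 DD' s t; rewrite /crossing !DD' (phi_intE phiI ee phi1).
by split=> -[h ?]; split=> //; [apply: gI|rewrite h].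
Qed.

Lemma reparametrized_sym D D' : reparametrized D D' -> reparametrized D' D.
Proof.
move=> [g [phi [[gc [g' [g'c gK g'K]]] [phic [psi [psic phiK psiK]]]
  [e ee phi1] DD']]].
have phin := phi_int phi1.
exists g', psi; split.
- by split=> //; exists g.
- by split=> //; exists phi.
- exists e => // t; apply: (can_inj phiK).
  by rewrite phin ee !psiK.
- move=> t; split; first by rewrite (DD' _).1 psiK gK.
  move=> [s st]; have h : double_param D' (psi t).
    exists (psi s).
    apply/(reparametrized_crossing (can_inj gK) (can_inj phiK) ee phi1) => [u|].
      exact: (DD' u).1.
    by rewrite !psiK.
  by rewrite (DD' _).2 // psiK.
Qed.

Lemma reparametrized_colorable D D' p :
  reparametrized D D' -> strong_colorable D p -> strong_colorable D' p.
Proof.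
move=> [g [phi [[gc [g' [g'c gK g'K]]] [phic [psi [psic phiK psiK]]]
  [e ee phi1] DD']]].
have phim : strictly_monotone phi.
  by apply: homeomorphism_monotone; split=> //; exists psi.
have cr := reparametrized_crossing (can_inj gK) (can_inj phiK) ee phi1
    (fun t => (DD' t).1).
move=> /strong_colorableP[c [c0 c1 c2] [s [t [sU tU st]]]].
apply/strong_colorableP; exists (c \o phi); first split.
- by move=> u n /=; rewrite (phi_int phi1) c0.
- move=> u uD; apply: (germ_comp_const (phic u) phim); apply: (c1 (phi u)) => -[w uw].
  by apply: uD; exists (psi w); apply/cr; rewrite psiK.
- move=> u w uw; rewrite (DD' u).2; last by exists w.
  by apply: (rule_at_comp2 (phic u) phim (phic w) phim); apply: c2; apply/cr.
have nU u : ~ underpass D u -> ~ underpass D' (psi u).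
  move=> uU [[w uw] ul]; apply: uU; split.
    by exists (phi w); rewrite -(psiK u); apply/cr.
  have h : double_param D' (psi u) by exists w.
  by rewrite -ul (DD' _).2 // psiK.
by exists (psi s), (psi t); rewrite /= !psiK; split => //; apply: nU.
Qed.

End Reparametrization.

(** * Charts *)

Section Tangles.
Context {R : realType} {n : nat} (T : tangle R n).

Definition meets (i : 'I_n) (v : R) (j : 'I_n) (w : R) : Prop :=
  [/\ -1 <= v <= 1, -1 <= w <= 1, (i, v) <> (j, w) &
      strand T i v = strand T j w].

Definition passes_under (i : 'I_n) (v : R) : Prop :=
  exists j w, meets i v j w /\ tangle_level T i j v = Under.

(** The counterpart of [local_coloring] for a picture. At [v = 1] and [v = -1] the germ reaches
    beyond [[-1, 1]]; without a crossing there, [k i] is constant around the end, which is what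
    gluing relies on. *)
Definition valid (A : comPzRingType) (k : 'I_n -> R -> A) : Prop :=
  (forall i v, -1 <= v <= 1 -> (forall j w, ~ meets i v j w) ->
     germ (k i) v (k i v) (k i v)) /\
  (forall i v j w, meets i v j w ->
     rule_at (k i) v (tangle_level T i j v) (k j) w).

Definition in_square (x : R * R) : Prop := -1 <= x.1 <= 1 /\ -1 <= x.2 <= 1.

Definition square_tangle : Prop :=
  forall i v, -1 <= v <= 1 -> in_square (strand T i v).

Definition inner_tangle : Prop :=
  forall i v j w, meets i v j w -> -1 < v < 1.

(** The constraints that a diagram puts on the levels of a picture found in it. They come for free
    from [charted_coherent], whatever the picture. *)
Definition coherent_tangle : Prop :=
  (forall i v j w j' w', meets i v j w -> meets i v j' w' ->
     tangle_level T i j v = tangle_level T i j' v) /\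
  (forall i v j w, meets i v j w ->
     tangle_level T j i w = opposite (tangle_level T i j v)).

Lemma meets_sym i v j w : meets i v j w -> meets j w i v.
Proof. by move=> [a b c d]; split=> // -[e f]; apply: c; rewrite e f. Qed.

End Tangles.

Section Segments.
Context {R : realType} {n : nat} (q r : 'I_n -> R).

Definition segments : Prop :=
  (forall i v, -1 <= v <= 1 -> 0 < q i + r i * v < 1) /\
  (forall i j v w, -1 <= v <= 1 -> -1 <= w <= 1 ->
     q i + r i * v = q j + r j * w -> i = j /\ v = w).

Definition off_segment (j : 'I_n) (t : R) : Prop :=
  forall v (m : int), -1 <= v <= 1 -> t <> q j + r j * v + m%:~R.

Definition outside (t : R) : Prop := forall j, off_segment j t.

Hypothesis seg : segments.

Lemma in_or_outside t :
  (exists i v (m : int), -1 <= v <= 1 /\ t = q i + r i * v + m%:~R) \/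
  outside t.
Proof.
have [?|N] := pselect (exists i v (m : int), -1 <= v <= 1 /\
  t = q i + r i * v + m%:~R); first by left.
by right=> i v m vI tE; apply: N; exists i, v, m.
Qed.

Lemma outside_int t (m : int) : outside t -> outside (t + m%:~R).
Proof.
move=> H j v m' vI tE; apply: (H j v (m' - m) vI).
by rewrite intrB addrA -tE addrK.
Qed.

Lemma radius_neq0 i : r i != 0.
Proof.
apply/eqP => ri.
have [] := seg.2 i i 1 (-1); rewrite ?ri ?mul0r //; try (apply/andP; split; lra).
by move=> _ ?; lra.
Qed.

Lemma segment_coord j (x : R) : `|x - q j| <= `|r j| ->
  -1 <= (x - q j) / r j <= 1.
Proof.
move=> H; rewrite -ler_norml normrM normfV ler_pdivrMr ?mul1r //.
by rewrite normr_gt0 radius_neq0.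
Qed.

Lemma segment_coordK j (x : R) : q j + r j * ((x - q j) / r j) = x.
Proof. by rewrite mulrC divfK ?radius_neq0 // addrC subrK. Qed.

Lemma coordK j (v : R) : (q j + r j * v - q j) / r j = v.
Proof. by rewrite addrC addKr [r j * v]mulrC mulfK // radius_neq0. Qed.

(** Each segment lies inside []0, 1[], so its integer translates are disjoint, one per period. The
    parameter [t] lies strictly between two consecutive translates, and the radius is its distance
    to the nearer one. *)
Lemma near_off_segment j t : off_segment j t ->
  \forall u \near t, off_segment j u.
Proof.
move=> tj.
have [l1 l2] : 0 < q j - `|r j| /\ q j + `|r j| < 1.
  have I1 : -1 <= (1 : R) <= 1 by apply/andP; split; lra.
  have I2 : -1 <= (-1 : R) <= 1 by apply/andP; split; lra.
  have /andP[a1 a2] := seg.1 j 1 I1; have /andP[b1 b2] := seg.1 j (-1) I2.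
  by have [?|?] := ger0P (r j); split; lra.
have bnd v : -1 <= v <= 1 -> - `|r j| <= r j * v <= `|r j|.
  move=> vI; rewrite -ler_norml normrM; apply: ler_piMr => //.
  by rewrite ler_norml.
have /andP[f1 f2] := floor_itv t; rewrite intrD in f2.
set f := (Num.floor t)%:~R in f1 f2.
have tj' : ~ (`|t - f - q j| <= `|r j|).
  move=> /segment_coord H; apply: (tj _ (Num.floor t) H).
  by rewrite segment_coordK subrK.
have [h|h] := lerP (t - f) (q j).
  have h' : t - f < q j - `|r j|.
    by rewrite ltNge; apply/negP => h2; apply: tj'; rewrite ler_norml; apply/andP; split; lra.
  apply/nearE; exists (Num.min (q j - `|r j| - (t - f)) ((t - f) + 1 - (q j + `|r j|))).
    by rewrite lt_min; apply/andP; split; lra.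
  move=> u; rewrite lt_min !ltr_norml => /andP[/andP[u1 u2] /andP[u3 u4]] v m vI uE.
  have /andP[b1 b2] := bnd v vI.
  by apply: (@int_lt_lt1 R m (Num.floor t)); rewrite -/f; lra.
have h' : q j + `|r j| < t - f.
  by rewrite ltNge; apply/negP => h2; apply: tj'; rewrite ler_norml; apply/andP; split; lra.
apply/nearE; exists (Num.min (t - f - (q j + `|r j|)) (1 + q j - `|r j| - (t - f))).
  by rewrite lt_min; apply/andP; split; lra.
move=> u; rewrite lt_min !ltr_norml => /andP[/andP[u1 u2] /andP[u3 u4]] v m vI uE.
have /andP[b1 b2] := bnd v vI.
by apply: (@int_lt_lt1 R (Num.floor t) m); rewrite -/f; lra.
Qed.

Lemma near_off_segments t :
  \forall u \near t, forall j, off_segment j t -> off_segment j u.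
Proof.
have H : \forall u \near t, forall j, j \in enum 'I_n ->
    off_segment j t -> off_segment j u.
  elim: (enum 'I_n) => [|i s IH]; first exact: filterE.
  have Hi : \forall u \near t, off_segment i t -> off_segment i u.
    have [/near_off_segment|N] := pselect (off_segment i t).
      by apply: filterS.
    exact: filterE.
  apply: filterS2 IH Hi => u hs hi j.
  by rewrite inE => /orP[/eqP ->|/hs].
by apply: filterS H => u H j; apply: H; rewrite mem_enum.
Qed.

Lemma near_outside t : outside t -> \forall u \near t, outside u.
Proof.
by move=> tO; apply: filterS (near_off_segments t) => u H j; apply/H/tO.
Qed.

Lemma segments_eq i j v w (m m' : int) : -1 <= v <= 1 -> -1 <= w <= 1 ->
  q i + r i * v + m%:~R = q j + r j * w + m'%:~R ->
  [/\ i = j, v = w & m = m'].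
Proof.
move=> vI wI E.
have /andP[a1 a2] := seg.1 i v vI; have /andP[b1 b2] := seg.1 j w wI.
have mm : m = m'.
  have [//|] := eqVneq m m'.
  rewrite neq_lt -!(ltr_int R) => /orP[] h; exfalso.
    by apply: (@int_lt_lt1 R m m'); lra.
  by apply: (@int_lt_lt1 R m' m); lra.
by rewrite mm in E *; have [-> ->] := seg.2 i j v w vI wI (addIr _ E).
Qed.

End Segments.

Lemma affine_monotone (R : realType) (a b : R) :
  a != 0 -> strictly_monotone (fun v => b + a * v).
Proof.
rewrite neq_lt => /orP[] a0; [right|left] => x y; rewrite ltrD2l.
  by rewrite ltr_nM2l.
by rewrite ltr_pM2l.
Qed.

Lemma affine_continuous (R : realType) (a b : R) :
  continuous (fun v => b + a * v).
Proof.
by move=> v; apply: cvgD; [exact: cvg_cst|apply: cvgM; [exact: cvg_cst|exact: cvg_id]].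
Qed.

Section Charts.
Context {R : realType} {n : nat} (T : tangle R n) (h : R * R -> R * R).
Context (q r : 'I_n -> R) (D : pseudodiagram R).

Definition charted : Prop :=
  [/\ homeomorphism h, segments q r, pictures T h q r D, square_tangle T &
      forall t, outside q r t -> ~ in_square (h (D t))].

Hypothesis ch : charted.

(** The other branch cannot lie outside the picture: by [square_tangle] the double point is in the
    square, which the rest of the curve avoids. *)
Lemma charted_crossing i v (m : int) t :
  -1 <= v <= 1 -> crossing D (q i + r i * v + m%:~R) t ->
  exists j w (m' : int), t = q j + r j * w + m'%:~R /\ meets T i v j w.
Proof.
move=> vI [DE /negP nI]; have [_ _ [st _] sq out] := ch.
have [[j [w [m' [wI tE]]]]|tO] := in_or_outside q r t.
  exists j, w, m'; split=> //; split=> //.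
    move=> [ij vw]; apply: nI; rewrite tE ij vw opprD addrACA subrr add0r.
    by rewrite -intrB intr_int.
  by rewrite -!st // -(curve_int D (q i + r i * v) m) DE tE curve_int.
exfalso; apply: (out t tO); rewrite -DE curve_int st //; exact: sq.
Qed.

Lemma charted_meets i v j w : meets T i v j w ->
  crossing D (q i + r i * v) (q j + r j * w).
Proof.
move=> [vI wI ne E]; have [[_ [h' [_ hK _]]] seg [st _] _ _] := ch; split.
  by apply: (can_inj hK); rewrite !st.
apply/negP => /intrP[m mE].
have [|ij vw _] := @segments_eq _ _ _ _ seg i j v w 0 m vI wI.
  by rewrite addr0 -mE [RHS]addrC subrK.
by apply: ne; rewrite ij vw.
Qed.

Lemma charted_level i v j w : meets T i v j w ->
  level D (q i + r i * v) = tangle_level T i j v.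
Proof. by move=> [vI wI ne E]; have [_ _ [_ lv] _ _] := ch; apply: lv E. Qed.

Lemma charted_coherent : coherent_tangle T.
Proof.
split=> [i v j w j' w' m m'|i v j w m].
  by rewrite -(charted_level m) (charted_level m').
rewrite -(charted_level m) -(charted_level (meets_sym m)).
exact/level_crossing/charted_meets.
Qed.

Lemma charted_outside s t : outside q r s -> crossing D s t -> outside q r t.
Proof.
move=> sO /crossing_sym st; have [//|] := in_or_outside q r t; last by [].
move=> [i [v [m [vI tE]]]]; rewrite tE in st.
have [j [w [m' [sE [_ wI _ _]]]]] := charted_crossing vI st.
by case: (sO j w m' wI).
Qed.

Lemma charted_underpass i v (m : int) : -1 <= v <= 1 ->
  underpass D (q i + r i * v + m%:~R) <-> passes_under T i v.
Proof.
move=> vI; rewrite underpass_int; split.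
  move=> [[t]]; rewrite -[q i + _]addr0 => /(charted_crossing (m := 0) vI).
  move=> [j [w [m' [_ M]]]]; rewrite addr0 => l.
  by exists j, w; split=> //; rewrite -(charted_level M).
move=> [j [w [M l]]]; split; last by rewrite (charted_level M).
by exists (q j + r j * w); apply: charted_meets.
Qed.

Lemma charted_valid p (c : R -> 'Z_p) : local_coloring D c ->
  valid T (fun i v => c (q i + r i * v)).
Proof.
move=> [c0 c1 c2]; have [_ seg _ _ _] := ch; split=> [i v vI N|i v j w M].
  apply: (@germ_comp_const _ _ c (fun v => q i + r i * v)).
  - exact: (@affine_continuous R (r i) (q i) v).
  - exact/affine_monotone/(radius_neq0 seg).
  apply: c1 => -[t]; rewrite -[q i + _]addr0 => /(charted_crossing (m := 0) vI).
  by move=> [j [w [m' [_ /N]]]].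
have := c2 _ _ (charted_meets M); rewrite (charted_level M).
apply: (@rule_at_comp2 _ _ c c (fun v => q i + r i * v) (fun v => q j + r j * v)).
- exact: (@affine_continuous R (r i) (q i) v).
- exact/affine_monotone/(radius_neq0 seg).
- exact: (@affine_continuous R (r j) (q j) w).
- exact/affine_monotone/(radius_neq0 seg).
Qed.

End Charts.

(** * Gluing *)

Section Glue.
Context {R : realType} {n : nat} (T T' : tangle R n) (h : R * R -> R * R).
Context (q r : 'I_n -> R) (D D' : pseudodiagram R) (p : nat).
Hypothesis ch : charted T h q r D.
Hypothesis ch' : charted T' h q r D'.
Hypothesis DD' : forall t, outside q r t ->
  D' t = D t /\ (double_param D t -> level D' t = level D t).

Lemma outside_crossing s t : outside q r s -> crossing D' s t -> crossing D s t.
Proof.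
move=> sO st; have tO := charted_outside ch' sO st.
by case: st => E ?; split=> //; rewrite -(DD' sO).1 -(DD' tO).1.
Qed.

Hypothesis inn : inner_tangle T.
Hypothesis inn' : inner_tangle T'.
Variables (c : R -> 'Z_p) (k : 'I_n -> R -> 'Z_p).
Hypothesis cl : local_coloring D c.
Hypothesis kv : valid T' k.
Hypothesis kc : forall i v, v = 1 \/ v = -1 -> k i v = c (q i + r i * v).

Let seg : segments q r. Proof. by case: ch. Qed.

Definition glue (t : R) : 'Z_p :=
  let x i := (t - (Num.floor t)%:~R - q i) / r i in
  if [pick i | -1 <= x i <= 1] is Some i then k i (x i) else c t.

Lemma glue_in i v (m : int) :
  -1 <= v <= 1 -> glue (q i + r i * v + m%:~R) = k i v.
Proof.
move=> vI; rewrite /glue.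
have -> : Num.floor (q i + r i * v + m%:~R) = m.
  by apply: floor_def; rewrite intrD; have /andP[? ?] := seg.1 i v vI; apply/andP; split; lra.
rewrite addrK; case: pickP => [j jI|/(_ i)]; last by rewrite coordK // vI.
have E : q i + r i * v + 0%:~R = q j + r j * ((q i + r i * v - q j) / r j) + 0%:~R.
  by rewrite segment_coordK.
by have [ij {2}-> _] := segments_eq seg vI jI E; rewrite -ij.
Qed.

Lemma glue_out t : outside q r t -> glue t = c t.
Proof.
move=> tO; rewrite /glue; case: pickP => // i iI.
by case: (tO i _ (Num.floor t) iI); rewrite segment_coordK // subrK.
Qed.

(** The inverse of [v -> q i + r i * v + m], put into the affine form for which monotonicity and
    continuity are proved. *)
Definition chart_coord (i : 'I_n) (m : int) (u : R) : R :=
  - (m%:~R + q i) / r i + (r i)^-1 * u.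

Lemma chart_coord_continuous i m : continuous (chart_coord i m).
Proof. exact: affine_continuous. Qed.

Lemma chart_coordK i m v : chart_coord i m (q i + r i * v + m%:~R) = v.
Proof.
by rewrite /chart_coord; have := radius_neq0 seg i; move=> ?; field.
Qed.

Lemma chart_coordKV i m u : q i + r i * chart_coord i m u + m%:~R = u.
Proof.
by rewrite /chart_coord; have := radius_neq0 seg i; move=> ?; field.
Qed.

(** Only the ends matter, for no parameter near an inner point of a segment is outside. At an end
    neither picture has a crossing, so [c] and [k i] are both locally constant there, and [kc]
    equates the two constants. *)
Lemma near_glue_outside i v (m : int) : -1 <= v <= 1 ->
  \forall u \near q i + r i * v + m%:~R,
    outside q r u -> c u = k i (chart_coord i m u).
Proof.
move=> vI; set t := _ + m%:~R; have tv := chart_coordK i m v.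
have phic (P : R -> Prop) : (\forall w \near v, P w) ->
    \forall u \near t, P (chart_coord i m u).
  by have := @chart_coord_continuous i m t; rewrite /continuous_at tv; apply.
have [vE|vN] := pselect (v = 1 \/ v = -1).
  have noT (U : tangle R n) j w : inner_tangle U -> ~ meets U i v j w.
    by move=> Ui /Ui /andP[? ?]; case: vE; lra.
  have /germ_constP kN : germ (k i) v (k i v) (k i v).
    by apply: kv.1 => // j w; apply: noT.
  have /germ_constP cN : germ c t (c t) (c t).
    have [_ c1 _] := cl; apply: c1 => -[s /(charted_crossing ch vI)].
    by move=> [j [w [m' [_ /noT]]]]; apply.
  have ct : c t = k i v by rewrite kc // /t; have [-> _ _] := cl.
  have kN' : \forall u \near t, k i (chart_coord i m u) = k i v.
    exact: (phic (fun w => k i w = k i v)).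
  by apply: filterS2 cN kN' => u -> ->.
have vI' : -1 < v < 1.
  by move/andP: vI => [v1 v2]; rewrite !lt_neqAle v1 v2 !andbT; apply/andP; split;
    apply/eqP => ?; apply: vN; [right|left].
have near_v : \forall w \near v, -1 <= w <= 1.
  move/andP: vI' => [v1 v2]; apply/nearE; exists (Num.min (1 - v) (1 + v)).
    by rewrite lt_min; apply/andP; split; lra.
  move=> w; rewrite lt_min !ltr_norml => /andP[/andP[w1 w2] /andP[w3 w4]].
  by apply/andP; split; lra.
have : \forall u \near t, -1 <= chart_coord i m u <= 1.
  exact: (phic (fun w => -1 <= w <= 1)).
apply: filterS => u uI uO.
by case: (uO i _ m uI); rewrite chart_coordKV.
Qed.

(** Around any point of a segment, also beyond an end where [glue] is [c], the glued labelling is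
    [k i] read in the chart. Thus its germs can be replaced by those of [k i]. *)
Lemma near_glue i v (m : int) : -1 <= v <= 1 ->
  \forall u \near q i + r i * v + m%:~R, glue u = k i (chart_coord i m u).
Proof.
move=> vI; have := near_glue_outside i m vI; set t := _ + m%:~R => H3.
have H1 := near_off_segments seg t.
have H2 : \forall u \near t, 0 < u - m%:~R < 1.
  have /andP[a b] := seg.1 i v vI.
  apply/nearE; exists (Num.min (q i + r i * v) (1 - (q i + r i * v))).
    by rewrite lt_min; apply/andP; split; lra.
  move=> u; rewrite /t lt_min !ltr_norml => /andP[/andP[w1 w2] /andP[w3 w4]].
  by apply/andP; split; lra.
apply: filterS3 H1 H2 H3 => u h1 /andP[u1 u2] h3.
have [[j [w [m' [wI uE]]]]|uO] := in_or_outside q r u; last first.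
  by rewrite glue_out // h3.
have ij : i = j.
  apply: contrapT => ij; have : off_segment q r j u; last by move=> /(_ w m' wI).
  by apply: h1 => w' m'' w'I tE; have [] := segments_eq seg vI w'I tE.
rewrite -ij in uE.
have mm : m' = m.
  have /andP[a b] := seg.1 i w wI.
  have [//|] := eqVneq m' m; rewrite neq_lt -!(ltr_int R) => /orP[] lt; exfalso.
    by apply: (@int_lt_lt1 R m' m); lra.
  by apply: (@int_lt_lt1 R m m'); lra.
by rewrite uE mm glue_in // chart_coordK.
Qed.

Lemma near_glue_out t : outside q r t -> \forall u \near t, c u = glue u.
Proof.
by move=> /(near_outside seg); apply: filterS => u /glue_out.
Qed.

Lemma chart_coord_monotone i m : strictly_monotone (chart_coord i m).
Proof. by apply: affine_monotone; rewrite invr_eq0 (radius_neq0 seg). Qed.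

(** The two parameters of a crossing of [D'] are both outside or both in the picture, so its rule
    comes entirely from [c] or entirely from [k]. *)
Lemma glue_coloring : local_coloring D' glue.
Proof.
have [c0 c1 c2] := cl; split.
- move=> t m; have [[i [v [m' [vI ->]]]]|tO] := in_or_outside q r t.
    by rewrite -addrA -intrD !glue_in.
  by rewrite !glue_out //; apply: outside_int.
- move=> t tD; have [[i [v [m [vI tE]]]]|tO] := in_or_outside q r t; last first.
    rewrite (glue_out tO); apply: germ_near (near_glue_out tO) _.
    apply: c1 => -[s st]; apply: tD; exists s.
    have sO := charted_outside ch tO st.
    by case: st => E ?; split=> //; rewrite (DD' tO).1 (DD' sO).1.
  rewrite tE glue_in //.
  apply: (@germ_near _ _ (k i \o chart_coord i m)).
    by apply: filterS (near_glue i m vI) => u ->.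
  apply: (germ_comp_const (@chart_coord_continuous i m _)).
    exact: chart_coord_monotone.
  rewrite chart_coordK; apply: kv.1 => // j w /(charted_meets ch') iv.
  apply: tD; exists (q j + r j * w); rewrite tE; exact/crossing_int.
- move=> s t st; have [[i [v [m [vI sE]]]]|sO] := in_or_outside q r s; last first.
    have tO := charted_outside ch' sO st.
    have st' := outside_crossing sO st.
    rewrite (DD' sO).2; last by exists t.
    apply: (rule_at_near (near_glue_out sO)).
    (* [rule_at_near] replaces the first labelling only; the second one is reached by exchanging the
       strands. *)
    rewrite -[level D s]oppositeK; apply/rule_at_sym.
    by apply: (rule_at_near (near_glue_out tO)); apply/rule_at_sym/c2.
  have := st; rewrite sE => /(charted_crossing ch' vI)[j [w [m' [tE M]]]].
  have [_ wI _ _] := M.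
  rewrite level_int (charted_level ch' M) tE.
  have near_k l u (a : int) : -1 <= u <= 1 ->
      \forall z \near q l + r l * u + a%:~R, (k l \o chart_coord l a) z = glue z.
    by move=> uI; apply: filterS (near_glue l a uI) => z ->.
  apply: (rule_at_near (near_k i v m vI)).
  rewrite -[tangle_level _ _ _ _]oppositeK; apply/rule_at_sym.
  apply: (rule_at_near (near_k j w m' wI)); apply/rule_at_sym.
  apply: rule_at_comp2; rewrite ?chart_coordK; try exact: chart_coord_monotone.
  + exact: chart_coord_continuous.
  + exact: chart_coord_continuous.
  + exact: kv.2.
Qed.

Hypothesis rigid : forall a, (forall i v, v = 1 \/ v = -1 -> k i v = a) ->
  forall i v, -1 <= v <= 1 -> ~ passes_under T i v -> c (q i + r i * v) = a.

(** Contrapositive: if [glue] had one label [a] on all arcs of [D'], then [c] would be [a] outside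
    and [k] would be [a] at all ends, and [rigid] would make [c] equal to [a] inside the picture as
    well. *)
Lemma glue_nontrivial : nontrivial_labelling D c -> nontrivial_labelling D' glue.
Proof.
have [c0 _ _] := cl.
move=> [s [t [sU tU st]]]; apply: contrapT => triv.
have glueE u w : ~ underpass D' u -> ~ underpass D' w -> glue u = glue w.
  by move=> uU wU; apply: contrapT => uw; apply: triv; exists u, w.
have outU u : outside q r u -> ~ underpass D u -> ~ underpass D' u.
  move=> uO uU [[w uw] ul]; have uw' := outside_crossing uO uw.
  have ud : double_param D u by exists w.
  by apply: uU; split=> //; rewrite -(DD' uO).2.
have endI v : v = 1 \/ v = -1 -> -1 <= v <= (1 : R).
  by move=> [] ->; apply/andP; split; lra.
have endU i v : v = 1 \/ v = -1 -> ~ underpass D' (q i + r i * v + 0%:~R).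
  move=> vE /(charted_underpass ch' i 0 (endI v vE)) [j [w [/inn' /andP[v1 v2] _]]].
  by case: vE; lra.
(* If [s] falls in the picture it may be an underpass of [D'], but an end of its strand is none, as
   [T'] has no crossing at the ends. *)
have [b bU] : exists b, ~ underpass D' b.
  have [[i _]|sO] := in_or_outside q r s; last by exists s; apply: outU.
  by exists (q i + r i * 1 + 0%:~R); apply: endU; left.
have cE u : ~ underpass D u -> c u = glue b.
  move=> uU; have [[i [v [m [vI uE]]]]|uO] := in_or_outside q r u; last first.
    by rewrite -glue_out //; apply: glueE => //; apply: outU.
  rewrite uE c0; apply: rigid => // [j w wE|].
    by rewrite -(glue_in j 0 (endI w wE)); apply: glueE => //; apply: endU.
  by move=> /(charted_underpass ch i m vI); rewrite -uE.
by apply: st; rewrite !cE.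
Qed.

End Glue.

Definition ends_extend (A : comPzRingType) (R : realType) (n : nat)
    (T T' : tangle R n) : Prop :=
  forall k : 'I_n -> R -> A, valid T k ->
    exists2 k', valid T' k' & forall i v, v = 1 \/ v = -1 -> k' i v = k i v.

Definition ends_determine (A : comPzRingType) (R : realType) (n : nat)
    (T : tangle R n) : Prop :=
  forall (k : 'I_n -> R -> A) a, valid T k ->
    (forall i v, v = 1 \/ v = -1 -> k i v = a) ->
    forall i v, -1 <= v <= 1 -> ~ passes_under T i v -> k i v = a.

Lemma charted_colorable (R : realType) (n : nat) (T T' : tangle R n) h q r
    (D D' : pseudodiagram R) p :
  charted T h q r D -> charted T' h q r D' ->
  (forall t, outside q r t ->
     D' t = D t /\ (double_param D t -> level D' t = level D t)) ->
  inner_tangle T -> inner_tangle T' ->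
  ends_extend 'Z_p T T' -> ends_determine 'Z_p T ->
  strong_colorable D p -> strong_colorable D' p.
Proof.
move=> ch ch' DD' inn inn' ext det /strong_colorableP[c cl cn].
apply/strong_colorableP.
have cv := charted_valid ch cl; have [k kv kc] := ext _ cv.
exists (glue q r c k); first exact: (glue_coloring ch ch').
apply: (glue_nontrivial ch ch') => // a ka i v vI iU.
by apply: (det _ a cv) => // j w wE; rewrite -kc // ka.
Qed.

Lemma local_move_colorable (R : realType) (n : nat) (T T' : tangle R n)
    (D D' : pseudodiagram R) p :
  square_tangle T -> square_tangle T' -> inner_tangle T -> inner_tangle T' ->
  (coherent_tangle T -> coherent_tangle T' ->
     ends_extend 'Z_p T T' /\ ends_extend 'Z_p T' T) ->
  ends_determine 'Z_p T -> ends_determine 'Z_p T' ->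
  local_move T T' D D' -> strong_colorable D p <-> strong_colorable D' p.
Proof.
move=> sq sq' inn inn' ext det det' [h [q [r [hh seg pT pT' out]]]].
(* [local_move] compares the diagrams on [[0, 1[] only; other parameters are reduced by their
   floor. *)
have fracO t : outside q r t -> [/\ D' (t - (Num.floor t)%:~R) = D (t - (Num.floor t)%:~R),
    double_param D (t - (Num.floor t)%:~R) ->
      level D' (t - (Num.floor t)%:~R) = level D (t - (Num.floor t)%:~R) &
    ~ in_square (h (D (t - (Num.floor t)%:~R)))].
  move=> tO; apply: out.
    by have /andP[? a] := floor_itv t; rewrite intrD in a; apply/andP; split; lra.
  move=> i v vI tE; apply: (tO i v (Num.floor t) vI).
  by rewrite -tE subrK.
have outE t : outside q r t -> [/\ D' t = D t,
    double_param D t -> level D' t = level D t & ~ in_square (h (D t))].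
  move=> /fracO; rewrite -intrN !curve_int !level_int => -[a b d]; split=> //.
  by move=> td; apply/b/double_param_int.
have ch : charted T h q r D by split=> // t /outE[].
have ch' : charted T' h q r D' by split=> // t /outE[-> _].
have {ext} [ext ext'] := ext (charted_coherent ch) (charted_coherent ch').
split; first by apply: (charted_colorable ch ch') => // t /outE[].
apply: (charted_colorable ch' ch) => // t tO; have [tE lE _] := outE t tO.
(* Levels are now wanted at double points of [D'], whereas the move gives them at those of [D];
   outside the disk these are the same. *)
split=> // -[s st]; rewrite lE //; exists s.
have sO := charted_outside ch' tO st.
have [sE _ _] := outE s sO.
by case: st => E ?; split=> //; rewrite -tE -sE.
Qed.

(** * Pictures crossing at parameters -1/2, 0, 1/2 *)

Section Grid.
Context {R : realType} {A : comPzRingType} {n : nat}.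
Implicit Type T : tangle R n.

(** Knots in the sense of splines. As [knot 3] is the right end 1, piece [a] is
    [[knot a - 1/2, knot a]] for every [a] up to 3. *)
Definition knot (a : nat) : R := (a%:R - 1) / 2.

Definition grid_tangle T : Prop :=
  forall i v j w, meets T i v j w -> exists2 a, (a < 3)%N & v = knot a.

(* The knots -1/2, 0, 1/2 of indices 0, 1, 2 cut [-1, 1] into four pieces, and
   [m i a] labels piece [a] of strand [i]; its midpoint is [knot a - 1 / 4]. *)
Definition grid_valid T (m : 'I_n -> nat -> A) : Prop :=
  (forall i a, (a < 3)%N -> (forall j w, ~ meets T i (knot a) j w) ->
     m i a.+1 = m i a) /\
  (forall i a j b, (a < 3)%N -> (b < 3)%N -> meets T i (knot a) j (knot b) ->
     crossing_rule (tangle_level T i j (knot a))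
       (m i a) (m i a.+1) (m j b) (m j b.+1)).

Lemma knot_in a : (a < 3)%N -> -1 < knot a < 1.
Proof. by rewrite /knot; case: a => [|[|[|//]]] _; apply/andP; split; lra. Qed.

Lemma grid_inner T : grid_tangle T -> inner_tangle T.
Proof. by move=> Tg i v j w /Tg[a /knot_in + ->]. Qed.

(** The index counts the knots up to [v], so a knot receives the label after it. At a passage that
    is not under, the labels before and after agree, so this choice satisfies [strand_germ]. *)
Definition step (m : nat -> A) (v : R) : A :=
  m ((knot 0 <= v)%R + (knot 1 <= v)%R + (knot 2 <= v)%R)%N.

Lemma step_knot m a : (a < 3)%N -> step m (knot a) = m a.+1.
Proof.
rewrite /step /knot => a3; congr m.
case: a a3 => [|[|[|//]]] _; do 3?[case: lerP => ?]; rewrite //=; exfalso; lra.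
Qed.

Lemma step_germ m a : (a < 3)%N -> germ (step m) (knot a) (m a) (m a.+1).
Proof.
move=> a3; exists (1 / 2); first lra.
move=> u /andP[u0 u1]; rewrite /step /knot; split; congr m;
  case: a a3 => [|[|[|//]]] _; do 3?[case: lerP => ?]; rewrite //=; exfalso; lra.
Qed.

Lemma step_germ_const m v : (forall a, (a < 3)%N -> v <> knot a) ->
  germ (step m) v (step m v) (step m v).
Proof.
move=> vN; apply/germ_constP.
have H a : (a < 3)%N -> \forall u \near v, (knot a <= u) = (knot a <= v).
  move=> /vN /eqP va.
  apply/nearE; exists `|v - knot a|; first by rewrite normr_gt0 subr_eq0.
  by move=> u; case: (ger0P (v - knot a)) => ?; rewrite ltr_norml => /andP[? ?];
    do 2!case: lerP => ?; rewrite //=; exfalso; lra.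
apply: filterS3 (H 0 isT) (H 1 isT) (H 2 isT) => u h0 h1 h2.
by rewrite /step h0 h1 h2.
Qed.

Lemma step_ends m : step m (-1) = m 0 /\ step m 1 = m 3.
Proof.
by rewrite /step /knot; split; congr m; do 3?[case: lerP => ?]; rewrite //=; exfalso; lra.
Qed.

Lemma step_valid T (m : 'I_n -> nat -> A) :
  grid_tangle T -> grid_valid T m -> valid T (fun i => step (m i)).
Proof.
move=> Tg [m1 m2]; split=> [i v vI N|i v j w M].
  have [[a [a3 va]]|vN] := pselect (exists a, (a < 3)%N /\ v = knot a).
    subst v; rewrite step_knot //.
    by have := step_germ (m i) a3; rewrite (m1 i a a3 N).
  by apply: step_germ_const => a a3 va; apply: vN; exists a.
have [a a3 va] := Tg _ _ _ _ M; have [b b3 wb] := Tg _ _ _ _ (meets_sym M).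
subst v w; have cr := m2 i a j b a3 b3 M.
exists (m i a), (m i a.+1), (m j b), (m j b.+1); split => //; split.
- exact: step_germ.
- by move=> /(crossing_rule_nonunder cr) <-; rewrite step_knot.
- exact: step_germ.
- by move=> /(crossing_rule_nonunder (crossing_rule_sym cr)) <-; rewrite step_knot.
Qed.

Definition sample (k : 'I_n -> R -> A) (i : 'I_n) (a : nat) : A :=
  k i (knot a - 1 / 4).

Section Sampling.
Variables (T : tangle R n) (k : 'I_n -> R -> A).
Hypotheses (Tg : grid_tangle T) (kv : valid T k).

Lemma sample_const i a v : (a <= 3)%N -> knot a - 1 / 2 <= v <= knot a ->
  (forall b, (b < 3)%N -> v <> knot b) -> k i v = sample k i a.
Proof.
move=> a3 /andP[v1 v2] vN.
have G u : -1 <= u <= 1 -> (forall b, (b < 3)%N -> u <> knot b) ->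
    germ (k i) u (k i u) (k i u).
  by move=> uI uN; apply: kv.1 => // j w /Tg[b b3 ub]; apply: (uN b).
have K b : (b < 3)%N -> v < knot b \/ knot b < v.
  by move=> /vN /eqP; rewrite neq_lt => /orP.
move: (K 0 isT) (K 1 isT) (K 2 isT) => k0 k1 k2.
rewrite /sample; have [h|h] := lerP v (knot a - 1 / 4); last apply/esym.
  apply: locally_const_segment => // u /andP[u1 u2]; apply: G.
    by rewrite /knot in v1 v2 u1 u2 *; case: a a3 v1 v2 u2 {h} => [|[|[|[|//]]]] _ *; apply/andP; split; lra.
  move=> [|[|[|//]]] _ ub; rewrite /knot in v1 v2 u1 u2 ub k0 k1 k2 *;
    case: a a3 v1 v2 u2 {h} => [|[|[|[|//]]]] _ *; lra.
apply: locally_const_segment; first exact: ltW.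
move=> u /andP[u1 u2]; apply: G.
  by rewrite /knot in v1 v2 u1 u2 *; case: a a3 v1 v2 u1 {h} => [|[|[|[|//]]]] _ *; apply/andP; split; lra.
move=> [|[|[|//]]] _ ub; rewrite /knot in v1 v2 u1 u2 ub k0 k1 k2 *;
  case: a a3 v1 v2 u1 {h} => [|[|[|[|//]]]] _ *; lra.
Qed.

Lemma sample_germ i a x y : (a < 3)%N -> germ (k i) (knot a) x y ->
  x = sample k i a /\ y = sample k i a.+1.
Proof.
move=> a3 g; apply: (germ_unique g); exists (1 / 2); first lra.
move=> u /andP[u0 u1]; split; apply: sample_const.
- exact: ltnW.
- by apply/andP; split; lra.
- by move=> [|[|[|//]]] _; rewrite /knot; case: a a3 {g} => [|[|[|//]]] _; lra.
- exact: a3.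
- by rewrite /knot -natr1; apply/andP; split; lra.
- by move=> [|[|[|//]]] _; rewrite /knot; case: a a3 {g} => [|[|[|//]]] _; lra.
Qed.

Lemma sample_valid : grid_valid T (sample k).
Proof.
split=> [i a a3 N|i a j b a3 b3 M].
  have /andP[k1 k2] := knot_in a3.
  have [|<- <- //] := @sample_germ i a (k i (knot a)) (k i (knot a)) a3.
  by apply: kv.1 => //; rewrite !ltW.
have [x [x' [y [y' [[gi _] [gj _] cr]]]]] := kv.2 _ _ _ _ M.
by have [<- <-] := sample_germ a3 gi; have [<- <-] := sample_germ b3 gj.
Qed.

Lemma sample_ends i : sample k i 0 = k i (-1) /\ sample k i 3 = k i 1.
Proof.
by split; apply/esym/sample_const => //; try (rewrite /knot; apply/andP; split; lra);
  move=> [|[|[|//]]] _; rewrite /knot; lra.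
Qed.

Lemma sample_nonunder i v : -1 <= v <= 1 -> ~ passes_under T i v ->
  exists2 a, (a <= 3)%N & k i v = sample k i a.
Proof.
move=> vI vU; have [[a [a3 va]]|vN] := pselect (exists a, (a < 3)%N /\ v = knot a).
  exists a; first exact: ltnW.
  have g : germ (k i) v (k i v) (k i v).
    have [[j [w M]]|N] := pselect (exists j w, meets T i v j w); last first.
      by apply: kv.1 => // j w M; apply: N; exists j, w.
    by apply: rule_at_nonunder (kv.2 _ _ _ _ M) _ => lU; apply: vU; exists j, w.
  by subst v; have [] := sample_germ a3 g.
have {}vN b : (b < 3)%N -> v <> knot b by move=> b3 vb; apply: vN; exists b.
have [a a3 va] : exists2 a, (a <= 3)%N & knot a - 1 / 2 <= v <= knot a.
  move/andP: vI => [v1 v2]; rewrite /knot.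
  have [?|?] := lerP v (-(1 / 2)); first by exists 0; rewrite //; apply/andP; split; lra.
  have [?|?] := lerP v 0; first by exists 1; rewrite //; apply/andP; split; lra.
  have [?|?] := lerP v (1 / 2); first by exists 2; rewrite //; apply/andP; split; lra.
  by exists 3; rewrite //; apply/andP; split; lra.
by exists a => //; apply: sample_const.
Qed.

End Sampling.

Lemma grid_ends_extend T T' : grid_tangle T -> grid_tangle T' ->
  (forall m, grid_valid T m -> exists2 m', grid_valid T' m' &
     forall i, m' i 0 = m i 0 /\ m' i 3 = m i 3) ->
  ends_extend A T T'.
Proof.
move=> Tg Tg' H k kv; have [m' mv me] := H _ (sample_valid Tg kv).
exists (fun i => step (m' i)); first exact: step_valid.
move=> i v; have [e0 e3] := sample_ends Tg kv i.
have [s0 s3] := step_ends (m' i); have [m0 m3] := me i.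
by case=> ->; [rewrite s3 m3|rewrite s0 m0].
Qed.

Lemma grid_ends_determine T : grid_tangle T ->
  (forall m b, grid_valid T m -> (forall i, m i 0 = b /\ m i 3 = b) ->
     forall i a, (a <= 3)%N -> m i a = b) ->
  ends_determine A T.
Proof.
move=> Tg H k b kv kb i v vI vU.
have [a a3 ->] := sample_nonunder Tg kv vI vU.
apply: H => //; first exact: sample_valid.
move=> j; have [-> ->] := sample_ends Tg kv j.
by rewrite (kb j 1 (or_introl erefl)) (kb j (-1) (or_intror erefl)).
Qed.

Lemma const_grid_valid T (b : A) : grid_valid T (fun _ _ => b).
Proof.
split=> // i a j a' _ _ _; rewrite /crossing_rule.
by case: tangle_level; split=> //; ring.
Qed.

Definition monochromatic T : Prop := forall m, grid_valid T m ->
  exists b, forall i a, (a <= 3)%N -> m i a = b.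

(** All ends of [T] carry one label, and a constant labelling is valid for any picture since
    [2 b - b = b]. *)
Lemma monochromatic_extend T T' : grid_tangle T -> grid_tangle T' ->
  monochromatic T -> ends_extend A T T'.
Proof.
move=> Tg Tg' Tm; apply: grid_ends_extend => // m /Tm[b mb].
by exists (fun _ _ => b); [exact: const_grid_valid|move=> i; rewrite !mb].
Qed.

Lemma monochromatic_determine T : grid_tangle T -> monochromatic T ->
  ends_determine A T.
Proof.
move=> Tg Tm; apply: grid_ends_determine => // m b /Tm[b' mb'] mb i a a3.
by rewrite mb' // -(mb i).1 mb'.
Qed.

End Grid.

(** * The pictures of the moves *)

Section Braids.
Context {R : realType} {n : nat} (T : tangle R n).
Variable X : nat -> option ('I_n * 'I_n).

(* The form of all pictures but the kink: the strands are graphs over the first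
   axis, so that they cross at equal parameters. *)
Definition braid : Prop := forall i v j w, meets T i v j w <->
  exists a, [/\ (a < 3)%N, v = knot a, w = knot a &
    X a = Some (i, j) \/ X a = Some (j, i)].

(** [X] is read as a braid word with one optional letter per knot; the labels are transferred from
    left to right through each letter. *)
Definition braid_valid (A : comPzRingType) (m : 'I_n -> nat -> A) : Prop :=
  forall a, (a < 3)%N ->
    match X a with
    | Some (i, j) =>
      crossing_rule (tangle_level T i j (knot a))
        (m i a) (m i a.+1) (m j a) (m j a.+1) /\
      forall l, l != i -> l != j -> m l a.+1 = m l a
    | None => forall l, m l a.+1 = m l a
    end.

Hypothesis TX : braid.

Lemma braid_grid : grid_tangle T.
Proof. by move=> i v j w /TX[a [a3 -> _ _]]; exists a. Qed.

Lemma knot_inj : injective (@knot R).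
Proof.
move=> a b /eqP; rewrite /knot (can_eq (mulfK _)) ?pnatr_eq0 //.
by rewrite (can_eq (addrK _)) eqr_nat => /eqP.
Qed.

Lemma braid_meets a i j : (a < 3)%N -> X a = Some (i, j) ->
  meets T i (knot a) j (knot a).
Proof. by move=> a3 E; apply/TX; exists a; split=> //; left. Qed.

Variables (A : comPzRingType) (m : 'I_n -> nat -> A).

Lemma grid_braid_valid : grid_valid T m -> braid_valid m.
Proof.
move=> [m1 m2] a a3; case E: (X a) => [[i j]|]; first split.
- by apply: m2 => //; apply: braid_meets.
- move=> l /eqP li /eqP lj; apply: m1 => // j' w /TX[a' [_ /knot_inj <- _]].
  by rewrite E => -[] [] *; [apply: li|apply: lj].
- by move=> l; apply: m1 => // j' w /TX[a' [_ /knot_inj <- _]]; rewrite E => -[].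
Qed.

(** The word names each crossing in one order of its strands, while [grid_valid] asks for both;
    coherence supplies the other order. *)
Lemma braid_grid_valid : coherent_tangle T -> braid_valid m -> grid_valid T m.
Proof.
move=> [_ opp] mv; split=> [i a a3 N|i a j b a3 b3 M].
  have := mv a a3; case E: (X a) => [[i' j']|]; last exact.
  move=> [_]; apply; apply/eqP => ii; subst i.
    exact: N (braid_meets a3 E).
  exact: N (meets_sym (braid_meets a3 E)).
have /TX[a' [_ /knot_inj ? /knot_inj ? XE]] := M; subst a' b.
have := mv a a3; case: XE => -> [cr _] //.
have M' := meets_sym M.
by rewrite (opp _ _ _ _ M'); apply: crossing_rule_sym.
Qed.

(** The label [b] is swept from the left ends to the right: a crossing whose incoming labels are
    both [b] has outgoing labels [b]. *)
Lemma braid_determine b : grid_valid T m -> (forall i, m i 0 = b /\ m i 3 = b) ->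
  forall i a, (a <= 3)%N -> m i a = b.
Proof.
move=> /grid_braid_valid mv mb i a; elim: a i => [|a IH] i a3.
  by have [] := mb i.
have := mv a a3; have a3' := ltnW a3.
case: (X a) => [[i' j']|]; last by move=> ->; apply: IH.
rewrite !IH // => -[cr E].
have [x y] : m i' a.+1 = b /\ m j' a.+1 = b.
  case: tangle_level cr => /= [[-> ->]|[-> ->]|[-> -> _]]; split=> //; ring.
have [->//|ii] := eqVneq i i'; have [->//|ij] := eqVneq i j'.
by rewrite E ?IH.
Qed.

End Braids.

(** * The pictures of R1 and PR1 *)

Section Kinks.
Context {R : realType}.

Lemma flat_square : square_tangle (@flat R).
Proof. by move=> i v /= vI; split=> //=; apply/andP; split; lra. Qed.

Lemma flat_braid : braid (@flat R) (fun _ => None).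
Proof.
move=> i v j w; split; last by move=> [a [_ _ _ []]].
by move=> [_ _ ne [vw]]; case: ne; rewrite vw (ord1 i) (ord1 j).
Qed.

Lemma flat_monochromatic (A : comPzRingType) : monochromatic (A := A) (@flat R).
Proof.
move=> m /(grid_braid_valid flat_braid) mv; exists (m ord0 0%N) => i a.
rewrite (ord1 i); elim: a => // a IH a3.
by rewrite (mv a a3) IH // ltnW.
Qed.

Lemma kink_square l : square_tangle (@kink R l).
Proof.
move=> i v /andP[v1 v2]; split; apply/andP; rewrite /=; split.
(* The first coordinate is -1 at [v = -1] and 1 at [v = 1], so [1 + v] and [1 - v] factor out; the
   remaining quadratic is a square plus a positive constant. *)
- rewrite -subr_ge0; have -> : v * (4 * v ^+ 2 - 1) / 3 - -1 =
    (1 + v) * (4 * (v - 1 / 2) ^+ 2 + 2) / 3 by field.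
  have h := sqr_ge0 (v - 1 / 2); apply: divr_ge0; last lra.
  by apply: mulr_ge0; lra.
- rewrite -subr_ge0; have -> : 1 - v * (4 * v ^+ 2 - 1) / 3 =
    (1 - v) * (4 * (v + 1 / 2) ^+ 2 + 2) / 3 by field.
  have h := sqr_ge0 (v + 1 / 2); apply: divr_ge0; last lra.
  by apply: mulr_ge0; lra.
- nra.
- nra.
Qed.

Lemma kink_meets l i v j w : meets (@kink R l) i v j w <->
  (v = knot 0 /\ w = knot 2) \/ (v = knot 2 /\ w = knot 0).
Proof.
rewrite (ord1 i) (ord1 j) /knot; split; last first.
  by move=> [] [-> ->]; split; try (apply/andP; split; lra);
    try (move=> [] ?; lra); congr pair; field.
(* The second coordinate is even and the first one odd: equal points have opposite parameters, at
   which the first coordinate vanishes. The root 0 would make the parameters equal. *)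
move=> [_ _ ne [xE yE]].
have vw : v != w by apply/eqP => vw; apply: ne; rewrite vw.
have /eqP : (v - w) * (v + w) = 0 by lra.
rewrite mulf_eq0 subr_eq0 (negbTE vw) /= addr_eq0 => /eqP vE.
have /eqP : w * (2 * w - 1) * (2 * w + 1) = 0.
  by move: xE; rewrite vE sqrrN => xE; lra.
rewrite !mulf_eq0 -orbA => /or3P[] /eqP wE.
- by exfalso; move/eqP: vw; apply; lra.
- by left; split; lra.
- by right; split; lra.
Qed.

Lemma kink_grid l : grid_tangle (@kink R l).
Proof. by move=> i v j w /kink_meets[] [-> _]; [exists 0|exists 2]. Qed.

Lemma kink_monochromatic l (A : comPzRingType) : monochromatic (A := A) (@kink R l).
Proof.
move=> m [m1 m2].
(* The loop is not cut at [knot 1], so the first passage leaves the double point with the label with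
   which the second one arrives. When the first passage is under, this gives [m 1 = 2 m 1 - m 0],
   hence [m 1 = m 0] without dividing by 2. *)
have h1 : m ord0 2 = m ord0 1.
  apply: m1 => // j w /kink_meets[] [] /knot_inj //.
have /= := m2 ord0 0 ord0 2 isT isT; rewrite ifT; last by rewrite /knot; lra.
move=> /(_ (proj2 (@kink_meets l _ _ _ _) (or_introl (conj erefl erefl)))).
move=> cr; exists (m ord0 0) => i a; rewrite (ord1 i) => a3.
have [e1 e3] : m ord0 1 = m ord0 0 /\ m ord0 3 = m ord0 0.
  case: l cr m1 m2 => /= cr _ _; rewrite h1 in cr.
  - by case: cr => e ->; rewrite e; split=> //; ring.
  - case: cr => -> e; split=> //.
      transitivity (2%:R * m ord0 1 - (2%:R * m ord0 1 - m ord0 0)); last by ring.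
      by rewrite -e; ring.
    transitivity (2%:R * m ord0 1 - (2%:R * m ord0 1 - m ord0 0)); last by ring.
    by rewrite -e; ring.
  - by case: cr => -> ->.
by case: a a3 => [|[|[|[|//]]]] _; rewrite ?h1.
Qed.

End Kinks.

(** * The pictures of R2 and PR2 *)

Section Bigons.
Context {R : realType}.

Let i0 : 'I_2 := ord0.
Let i1 : 'I_2 := ord_max.

Lemma ord2P (i : 'I_2) : i = i0 \/ i = i1.
Proof. by case: i => [[|[|//]]] ?; [left|right]; apply: val_inj. Qed.

Lemma separate_square ht : square_tangle (@separate R ht).
Proof.
move=> i v /andP[v1 v2]; split=> /=; first by rewrite v1.
by case: ifP => _; apply/andP; split; lra.
Qed.

Lemma separate_braid ht : braid (@separate R ht) (fun _ => None).
Proof.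
move=> i v j w; split; last by move=> [a [_ _ _ []]].
move=> [_ _ ne [vw yE]]; case: ne; rewrite vw; congr pair.
case: (ord2P i) (ord2P j) yE => -> [] -> //= yE; exfalso; lra.
Qed.

Lemma bigon_square lv : square_tangle (Tangle (@bigon_strands R) lv).
Proof.
move=> i v /andP[v1 v2]; split=> /=; first by rewrite v1.
by case: ifP => _; apply/andP; split; nra.
Qed.

Definition bigon_word (a : nat) : option ('I_2 * 'I_2) :=
  if a == 1%N then None else Some (i0, i1).

Lemma bigon_braid lv : braid (Tangle (@bigon_strands R) lv) bigon_word.
Proof.
have eq0 (v : R) : 0 = (4 * v ^+ 2 - 1) / 6 ->
    exists a, [/\ (a < 3)%N, v = knot a & bigon_word a = Some (i0, i1)].
  move=> vE; have /eqP : (2 * v + 1) * (2 * v - 1) = 0 by lra.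
  rewrite mulf_eq0 => /orP[] /eqP ?.
    by exists 0%N; split=> //; rewrite /knot; lra.
  by exists 2%N; split=> //; rewrite /knot; lra.
move=> i v j w; split.
  move=> [_ _ ne [vw yE]]; subst w.
  case: (ord2P i) (ord2P j) ne yE => -> [] -> //= ne.
    by move=> /eq0[a [a3 vE aE]]; exists a; split=> //; left.
  by move=> /esym /eq0[a [a3 vE aE]]; exists a; split=> //; right.
have knot0 (a : nat) : (a < 3)%N -> bigon_word a = Some (i0, i1) ->
    (4 * knot a ^+ 2 - 1) / 6 = 0 :> R.
  by move=> a3; case: a a3 => [|[|[|//]]] //= _ _; rewrite /knot; field.
move=> [a [a3 -> -> aE]]; have /andP[k1 k2] := @knot_in R a a3.
have aE' : bigon_word a = Some (i0, i1).
  by rewrite /bigon_word in aE *; case: ifP aE => // _ [].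
have k0 := knot0 a a3 aE'.
by case: aE; rewrite aE' => -[<- <-]; split; rewrite ?ltW //= /bigon_strands /= k0.
Qed.

(** The precrossing gives both strands one label, and the other crossing transmits equal labels
    unchanged whatever its level. When the precrossing is on the right, the left crossing is read
    backwards. *)
Lemma bigon_pre_monochromatic (A : comPzRingType)
    (lv : 'I_2 -> 'I_2 -> R -> passage) :
  lv i0 i1 (knot 0) = Pre \/ lv i0 i1 (knot 2) = Pre ->
  monochromatic (A := A) (Tangle (@bigon_strands R) lv).
Proof.
move=> lvP m /(grid_braid_valid (bigon_braid _)) mv.
have [/= c0 _] := mv 0 isT; have /= c1 := mv 1 isT; have [/= c2 _] := mv 2 isT.
rewrite !c1 in c2.
suff [b mb] : exists b, [/\ m i0 0 = b, m i0 1 = b, m i0 3 = b & m i1 0 = b] /\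
    (m i1 1 = b /\ m i1 3 = b).
  case: mb => -[h1 h2 h3 h4] [h5 h6]; exists b => i a.
  by case: a => [|[|[|[|//]]]] _; case: (ord2P i) => ->; rewrite ?c1.
case: lvP => lE.
  move: c0; rewrite lE => -[e1 e2 e3]; rewrite e1 e2 -e3 in c2.
  have [h3 h6] := crossing_rule_const c2.
  by exists (m i0 0); rewrite e1 e2 h3 h6 e3.
move: c2; rewrite lE => -[e1 e2 e3].
have := crossing_rule_revl (crossing_rule_revr c0).
rewrite -e3 => /crossing_rule_const[h0 h4].
by exists (m i0 1); rewrite e1 e2 h0 h4 e3.
Qed.

Lemma overlap_extend (A : comPzRingType) (ht : 'I_2 -> nat) : injective ht ->
  coherent_tangle (@overlap R ht) -> ends_extend A (@separate R ht) (overlap ht).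
Proof.
move=> hti co; apply: grid_ends_extend.
- exact: braid_grid (separate_braid ht).
- exact: braid_grid (bigon_braid _).
move=> m /(grid_braid_valid (separate_braid ht)) mv.
have c i a : (a <= 3)%N -> m i a = m i 0.
  by elim: a => // a IH a3; rewrite (mv a a3) IH // ltnW.
(* [u] and [w] are the labels inside the bigon. The second crossing has the same over-strand and
   undoes the reflection, so the outer labels return. *)
have [u [w uw]] : exists u w, crossing_rule (by_height ht i0 i1 (0 : R))
    (m i0 0) u (m i1 0) w.
  rewrite /by_height; case: ltngtP => [_|_|/hti //].
    by exists (m i0 0), (2%:R * m i0 0 - m i1 0).
  by exists (2%:R * m i1 0 - m i0 0), (m i1 0).
pose m' (i : 'I_2) a :=
  nth 0 (if i == i0 then [:: m i0 0; u; u; m i0 0] else [:: m i1 0; w; w; m i1 0]) a.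
exists m'; last first.
  by move=> i; rewrite !c //; case: (ord2P i) => ->.
apply: (braid_grid_valid (bigon_braid _)) => // a.
case: a => [|[|[|//]]] _ /=.
- by split=> // l; case: (ord2P l) => ->.
- by move=> l; case: (ord2P l) => ->.
- split; last by move=> l; case: (ord2P l) => ->.
  exact/crossing_rule_revl/crossing_rule_revr.
Qed.

Lemma separate_extend (A : comPzRingType) (ht : 'I_2 -> nat) : injective ht ->
  ends_extend A (@overlap R ht) (separate ht).
Proof.
move=> hti; apply: grid_ends_extend.
- exact: braid_grid (bigon_braid _).
- exact: braid_grid (separate_braid ht).
move=> m /(grid_braid_valid (bigon_braid _)) mv.
have [/= c0 _] := mv 0 isT; have /= c1 := mv 1 isT; have [/= c2 _] := mv 2 isT.
rewrite !c1 in c2.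
exists (fun i _ => m i 0).
  by split=> // i a j b _ _ /(separate_braid ht)[? [_ _ _ []]].
suff [h0 h1] : m i0 3 = m i0 0 /\ m i1 3 = m i1 0.
  by move=> i; case: (ord2P i) => ->.
move: c0 c2; rewrite /by_height; case: ltngtP => [_|_|/hti //] /= -[-> ->] [-> ->].
  by rewrite subKr.
by rewrite subKr.
Qed.

End Bigons.

(** * The pictures of R3, PR3 and PR3' *)

Section Slides.
Context {R : realType}.

Let i0 : 'I_3 := inord 0.
Let i1 : 'I_3 := inord 1.
Let i2 : 'I_3 := inord 2.

Lemma ord3P (i : 'I_3) : [\/ i = i0, i = i1 | i = i2].
Proof.
by case: i => [[|[|[|//]]]] ?; [apply: Or31|apply: Or32|apply: Or33];
  apply: val_inj; rewrite /= inordK.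
Qed.

Lemma slide_strandsE (e v : R) :
  [/\ slide_strands e i0 v = (v, v / 2), slide_strands e i1 v = (v, - v / 2) &
      slide_strands e i2 v = (v, e * (1 - v ^+ 2) / 3)].
Proof. by rewrite /slide_strands /= !inordK. Qed.

Lemma ord3_neq : [/\ i0 != i1, i0 != i2 & i1 != i2].
Proof. by rewrite -!val_eqE /= !inordK. Qed.

Lemma slide_square (e : R) ht : e ^+ 2 = 1 -> square_tangle (slide e ht).
Proof.
move=> /eqP; rewrite sqrf_eq1 => /orP eE i v /andP[v1 v2].
have [E0 E1 E2] := slide_strandsE e v.
case: (ord3P i) => -> /=; rewrite ?E0 ?E1 ?E2; split=> /=; rewrite ?v1 //;
  try (by apply/andP; split; lra).
by case: eE => /eqP ->; apply/andP; split; nra.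
Qed.

(** The two sides of the braid relation. For [b] true strand 2 goes above the origin, so it meets
    the descending strand 1 on the left and the ascending strand 0 on the right. *)
Definition slide_word (b : bool) (a : nat) : option ('I_3 * 'I_3) :=
  match a with
  | 0 => Some (if b then (i1, i2) else (i0, i2))
  | 1 => Some (i0, i1)
  | _ => Some (if b then (i0, i2) else (i1, i2))
  end.

Lemma slide_braid (b : bool) (e : R) ht : e = (if b then 1 else -1) ->
  braid (slide e ht) (slide_word b).
Proof.
move=> eE i v j w; have [n01 n02 n12] := ord3_neq.
have mk (x y : 'I_3) (a : nat) : (a < 3)%N ->
    slide_word b a = Some (x, y) -> meets (slide e ht) x (knot a) y (knot a).
  move=> a3 aE; have /andP[k1 k2] := @knot_in R a a3.
  have [E0 E1 E2] := slide_strandsE e (knot a).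
  split; rewrite ?ltW //.
    move=> [xy]; move: aE; rewrite xy; case: a a3 {k1 k2 E0 E1 E2} => [|[|[|//]]] _ /=;
      case: (b) => -[] h1 h2; subst; move: n01 n02 n12; rewrite ?h2 ?eqxx //.
  rewrite /=; move: aE E0 E1 E2; rewrite eE /knot.
  by case: a a3 {k1 k2} => [|[|[|//]]] _ /=; case: (b) => -[<- <-] E0 E1 E2;
    rewrite ?E0 ?E1 ?E2; congr pair; field.
split; last first.
  move=> [a [a3 -> -> [aE|aE]]]; first exact: mk.
  exact/meets_sym/mk.
move=> [/andP[v1 v2] _ ne]; rewrite /=.
have [E0 E1 E2] := slide_strandsE e v; have [F0 F1 F2] := slide_strandsE e w.
have root01 : v / 2 = - v / 2 -> v = knot 1 by rewrite /knot; lra.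
(* Each quadratic has one root at a knot; the other one, 2 or -2, is outside [[-1, 1]]. *)
have root02 : v / 2 = e * (1 - v ^+ 2) / 3 -> v = knot (if b then 2 else 0).
  rewrite eE; case: (b) => H.
    have /eqP : (2 * v - 1) * (v + 2) = 0 by lra.
    by rewrite mulf_eq0 => /orP[] /eqP ?; rewrite /knot; lra.
  have /eqP : (2 * v + 1) * (v - 2) = 0 by lra.
  by rewrite mulf_eq0 => /orP[] /eqP ?; rewrite /knot; lra.
have root12 : - v / 2 = e * (1 - v ^+ 2) / 3 -> v = knot (if b then 0 else 2).
  rewrite eE; case: (b) => H.
    have /eqP : (2 * v + 1) * (v - 2) = 0 by lra.
    by rewrite mulf_eq0 => /orP[] /eqP ?; rewrite /knot; lra.
  have /eqP : (2 * v - 1) * (v + 2) = 0 by lra.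
  by rewrite mulf_eq0 => /orP[] /eqP ?; rewrite /knot; lra.
case: (ord3P i) (ord3P j) ne => -> [] -> ne; rewrite ?E0 ?E1 ?E2 ?F0 ?F1 ?F2 => -[vw yE];
  subst w; try (by case: ne).
- by exists 1%N; rewrite -(root01 yE); split=> //; left.
- by exists (if b then 2 else 0)%N; rewrite -(root02 yE); split=> //; case: (b) => //; left.
- by exists 1%N; rewrite -(root01 (esym yE)); split=> //; right.
- by exists (if b then 0 else 2)%N; rewrite -(root12 yE); split=> //; case: (b) => //; left.
- by exists (if b then 2 else 0)%N; rewrite -(root02 (esym yE)); split=> //; case: (b) => //; right.
- by exists (if b then 0 else 2)%N; rewrite -(root12 (esym yE)); split=> //; case: (b) => //; right.
Qed.

(** Self-distributivity of [2 y - x]; [x0], [x1], [x2] are the labels at the left ends and [t0],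
    [z1], [t2] those at the right ends. For [h0 = h1] the middle crossing demands two equal labels:
    a strand over both reflects both in the same label, and a strand under both is reflected in
    equal labels, so the demand is the same before and after the slide. *)
Lemma yang_baxter (A : comPzRingType) (h0 h1 h2 : nat) (x0 x1 x2 y1 y2 z0 z1 t0 t2 : A) :
  let l (a b : nat) := if (b < a)%N then Over else if (a < b)%N then Under else Pre in
  h0 <> h2 -> h1 <> h2 ->
  crossing_rule (l h1 h2) x1 y1 x2 y2 -> crossing_rule (l h0 h1) x0 z0 y1 z1 ->
  crossing_rule (l h0 h2) z0 t0 y2 t2 ->
  exists u w z, [/\ crossing_rule (l h0 h2) x0 u x2 w,
    crossing_rule (l h0 h1) u t0 x1 z & crossing_rule (l h1 h2) z z1 w t2].
Proof.
move=> l; rewrite {}/l => n02 n12 c12 c01 c02.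
(* The witnesses are forced: [u] and [w] by the crossing of strands 0 and 2, which now comes first,
   and then [z] by that of strands 0 and 1. *)
pose u := if (h2 < h0)%N then x0 else 2%:R * x2 - x0.
exists u, (if (h2 < h0)%N then 2%:R * x0 - x2 else x2).
exists (if (h1 < h0)%N then 2%:R * u - x1 else x1); rewrite {}/u.
move: c12 c01 c02; case: (ltngtP h2 h1) => h12; case: (ltngtP h2 h0) => h02;
  case: (ltngtP h1 h0) => h01 /=;
  try (by exfalso; lia); move=> [? ?] + [? ?]; move=> [] *; subst;
  (repeat split); ring.
Qed.

Lemma slide_extend_down (A : comPzRingType) (ht : 'I_3 -> nat) :
  ht i0 <> ht i2 -> ht i1 <> ht i2 -> coherent_tangle (@slide R (-1) ht) ->
  ends_extend A (@slide R 1 ht) (slide (-1) ht).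
Proof.
move=> n02 n12 co; have B1 := @slide_braid true 1 ht erefl.
have B2 := @slide_braid false (-1) ht erefl.
apply: grid_ends_extend; [exact: braid_grid B1|exact: braid_grid B2|].
move=> m /(grid_braid_valid B1) mv; have [e01 e02 e12] := ord3_neq.
have [/= c12 E0] := mv 0 isT; have [/= c01 E1] := mv 1 isT.
have [/= c02 E2] := mv 2 isT.
have {}E0 := E0 i0 e01 e02.
have {}E1 := E1 i2; rewrite eq_sym e02 eq_sym e12 in E1; have {}E1 := E1 isT isT.
have {}E2 := E2 i1; rewrite eq_sym e01 e12 in E2; have {}E2 := E2 isT isT.
rewrite E0 in c01; rewrite E1 in c02.
have [u [w [z [d02 d01 d12]]]] := yang_baxter n02 n12 c12 c01 c02.
(* Each row lists the labels of a strand on its four pieces; a label is repeated at the knot where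
   the strand meets no other. *)
pose m' (i : 'I_3) a := nth 0 (if i == i0 then [:: m i0 0; u; m i0 3; m i0 3]
  else if i == i1 then [:: m i1 0; m i1 0; z; m i1 3]
  else [:: m i2 0; w; w; m i2 3]) a.
have n10 : (i1 == i0) = false by rewrite eq_sym (negbTE e01).
have n20 : (i2 == i0) = false by rewrite eq_sym (negbTE e02).
have n21 : (i2 == i1) = false by rewrite eq_sym (negbTE e12).
exists m'; last first.
  by move=> i; rewrite /m'; case: (ord3P i) => ->; rewrite ?eqxx ?n10 ?n20 ?n21.
apply: (braid_grid_valid B2) => // a.
case: a => [|[|[|//]]] _ /=; split; rewrite /m' ?eqxx ?n10 ?n20 ?n21 //=;
  try (by move=> l; case: (ord3P l) => ->; rewrite ?eqxx ?n10 ?n20 ?n21).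
by rewrite E2.
Qed.

(** Read from right to left, the word of the lower slide is that of the upper one. As the crossing
    rule is reversible, [yang_baxter] applies with the labels at the right ends as input. *)
Lemma slide_extend_up (A : comPzRingType) (ht : 'I_3 -> nat) :
  ht i0 <> ht i2 -> ht i1 <> ht i2 -> coherent_tangle (@slide R 1 ht) ->
  ends_extend A (@slide R (-1) ht) (slide 1 ht).
Proof.
move=> n02 n12 co; have B1 := @slide_braid true 1 ht erefl.
have B2 := @slide_braid false (-1) ht erefl.
apply: grid_ends_extend; [exact: braid_grid B2|exact: braid_grid B1|].
move=> m /(grid_braid_valid B2) mv; have [e01 e02 e12] := ord3_neq.
have n10 : (i1 == i0) = false by rewrite eq_sym (negbTE e01).
have n20 : (i2 == i0) = false by rewrite eq_sym (negbTE e02).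
have n21 : (i2 == i1) = false by rewrite eq_sym (negbTE e12).
have rev l x x' y y' (H : crossing_rule (A := A) l x x' y y') :=
  crossing_rule_revl (crossing_rule_revr H).
have [/= c02 E0] := mv 0 isT; have [/= c01 E1] := mv 1 isT.
have [/= c12 E2] := mv 2 isT.
have {}E0 := E0 i1; rewrite n10 e12 in E0; have {}E0 := E0 isT isT.
have {}E1 := E1 i2; rewrite n20 n21 in E1; have {}E1 := E1 isT isT.
have {}E2 := E2 i0 e01 e02.
rewrite E0 -E2 in c01; rewrite E1 in c12.
have [u [w [z [d02 d01 d12]]]] :=
  yang_baxter n02 n12 (rev _ _ _ _ _ c12) (rev _ _ _ _ _ c01) (rev _ _ _ _ _ c02).
pose m' (i : 'I_3) a := nth 0 (if i == i0 then [:: m i0 0; m i0 0; u; m i0 3]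
  else if i == i1 then [:: m i1 0; z; m i1 3; m i1 3]
  else [:: m i2 0; w; w; m i2 3]) a.
exists m'; last first.
  by move=> i; rewrite /m'; case: (ord3P i) => ->; rewrite ?eqxx ?n10 ?n20 ?n21.
apply: (braid_grid_valid B1) => // a.
case: a => [|[|[|//]]] _ /=; split; rewrite /m' ?eqxx ?n10 ?n20 ?n21 //=;
  try (by move=> l; case: (ord3P l) => ->; rewrite ?eqxx ?n10 ?n20 ?n21);
  exact: rev.
Qed.

(** Serves R3, PR3 and PR3' together: strands 0 and 1 may have equal heights, in which case they
    meet at a precrossing. *)
Lemma slide_colorable (ht : 'I_3 -> nat) (D D' : pseudodiagram R) p :
  ht i0 <> ht i2 -> ht i1 <> ht i2 ->
  local_move (slide 1 ht) (slide (-1) ht) D D' ->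
  strong_colorable D p <-> strong_colorable D' p.
Proof.
move=> n02 n12; have B1 := @slide_braid true 1 ht erefl.
have B2 := @slide_braid false (-1) ht erefl.
apply: local_move_colorable.
- by apply: slide_square; rewrite expr1n.
- by apply: slide_square; rewrite sqrrN expr1n.
- exact/grid_inner/braid_grid/B1.
- exact/grid_inner/braid_grid/B2.
- by move=> co co'; split; [apply: slide_extend_down|apply: slide_extend_up].
- by apply: grid_ends_determine => [|m b]; [exact: braid_grid B1|exact: (braid_determine B1)].
- by apply: grid_ends_determine => [|m b]; [exact: braid_grid B2|exact: (braid_determine B2)].
Qed.

End Slides.

(** * Invariance under each move *)

Section Moves.
Context {R : realType}.
Variables (p : nat) (D D' : pseudodiagram R).

Lemma overlap_colorable (ht : 'I_2 -> nat) : injective ht ->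
  local_move (separate ht) (overlap ht) D D' ->
  strong_colorable D p <-> strong_colorable D' p.
Proof.
move=> hti; have B1 := @separate_braid R ht.
have B2 := @bigon_braid R (by_height ht).
apply: local_move_colorable.
- exact: separate_square.
- exact: bigon_square.
- exact/grid_inner/braid_grid/B1.
- exact/grid_inner/braid_grid/B2.
- by move=> co co'; split; [apply: overlap_extend|apply: separate_extend].
- by apply: grid_ends_determine => [|m b]; [exact: braid_grid B1|exact: (braid_determine B1)].
- by apply: grid_ends_determine => [|m b]; [exact: braid_grid B2|exact: (braid_determine B2)].
Qed.

Lemma monochromatic_colorable n (T T' : tangle R n) :
  square_tangle T -> square_tangle T' -> grid_tangle T -> grid_tangle T' ->
  monochromatic (A := 'Z_p) T -> monochromatic (A := 'Z_p) T' ->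
  local_move T T' D D' -> strong_colorable D p <-> strong_colorable D' p.
Proof.
move=> sq sq' g g' m m'; apply: local_move_colorable => //.
- exact: grid_inner.
- exact: grid_inner.
- by move=> _ _; split; apply: monochromatic_extend.
- exact: monochromatic_determine.
- exact: monochromatic_determine.
Qed.

Lemma move_colorable :
  move D D' -> strong_colorable D p <-> strong_colorable D' p.
Proof.
have kinkP l : local_move flat (kink l) D D' ->
    strong_colorable D p <-> strong_colorable D' p.
  apply: monochromatic_colorable.
  - exact: flat_square.
  - exact: kink_square.
  - exact: braid_grid flat_braid.
  - exact: kink_grid.
  - exact: flat_monochromatic.
  - exact: kink_monochromatic.
case=> [iso|l _|ht|ht hti||l _|ht h01 h2|ht h01 h2].
- have re := isotopy_reparametrized iso; split; apply: reparametrized_colorable => //.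
  exact: reparametrized_sym.
- exact: kinkP.
- exact: overlap_colorable.
- by apply: slide_colorable => /hti /eqP; rewrite -val_eqE /= !inordK.
- exact: kinkP.
- apply: monochromatic_colorable.
  + exact: bigon_square.
  + exact: bigon_square.
  + exact: braid_grid (bigon_braid _).
  + exact: braid_grid (bigon_braid _).
  + by apply: bigon_pre_monochromatic; left; rewrite /knot ifT //; lra.
  + by apply: bigon_pre_monochromatic; right; rewrite /knot ifF //; apply/negbTE; rewrite -leNgt; lra.
- by apply: slide_colorable; rewrite -?h01 => E; rewrite E ltnn in h2.
- by apply: slide_colorable; rewrite -?h01 => E; rewrite E ltnn in h2.
Qed.

End Moves.

Theorem theorem1 (R : realType) (p : nat) (hp : (2 <= p)%N)
    (D D' : pseudodiagram R) (hDD' : same_pseudoknot D D') :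
  strong_colorable D p <-> strong_colorable D' p.
Proof.
elim: hDD' => {D D'} [D D'|D|D D' _ [? ?]|D1 D2 D3 _ [? ?] _ [? ?]].
- exact: move_colorable.
- by [].
- by split.
- by split=> ?; auto.
Qed.
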